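(* Let $(X,d,\alpha)$ be a computable metric space. Let $S$ be a semi-computable compact set in this space such that $S$, as a subspace of $(X,d)$, is a manifold. Then $S$ is a computable compact set in $(X,d,\alpha)$.
   Context: A computable metric space is a triple $(X,d,\alpha)$ where $(X,d)$ is a metric space and $\alpha=(\alpha_i)_{i\in\mathbb N}$ is a sequence with dense range in $(X,d)$ such that $(i,j)\mapsto d(\alpha_i,\alpha_j)$ is a computable function $\mathbb N^2\to\mathbb R$ (a function $g:\mathbb N^k\to\mathbb R$ is computable if there is a computable $G:\mathbb N^{k+1}\to\mathbb Q$ with $|g(x)-G(x,i)|<2^{-i}$ for all $x,i$). Fix a computable $q:\mathbb N\to\mathbb Q$ whose image is the set of positive rationals and computable $\tau_1,\tau_2:\mathbb N\to\mathbb N$ with $\{(\tau_1(i),\tau_2(i)):i\in\mathbb N\}=\mathbb N^2$; let $\lambda_i=\alpha_{\tau_1(i)}$, $\rho_i=q_{\tau_2(i)}$, $I_i=B(\lambda_i,\rho_i)$ (open ball). Fix computable $\sigma:\mathbb N^2\to\mathbb N$, $\eta:\mathbb N\to\mathbb N$ such that $\{(\sigma(j,0),\dots,\sigma(j,\eta(j))):j\in\mathbb N\}$ is the set of all nonempty finite sequences in $\mathbb N$; let $[j]=\{\sigma(j,i):0\le i\le\eta(j)\}$ and $J_j=\bigcup_{i\in[j]}I_i$. A set $K\subseteq X$ is a semi-computable compact set if $K$ is compact in $(X,d)$ and $\{j\in\mathbb N: K\subseteq J_j\}$ is computably enumerable; it is a computable compact set if moreover $\{i\in\mathbb N: K\cap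 I_i\neq\emptyset\}$ is computably enumerable. A manifold is a nonempty topological space which, for some $n\ge1$, has each point possessing a neighborhood homeomorphic to $\mathbb R^n$. *)

(* Defs.v *)
From Stdlib Require Import Reals List Arith.
Open Scope R_scope.

(* A standard model of computation: partial recursive (mu-recursive)      *)
(* functions nat -> nat, tuples being coded with the Cantor pairing.      *)

Definition cpair (x y : nat) : nat := ((x + y) * (x + y + 1) / 2 + y)%nat.

Inductive prf : Type :=
| PZero : prf
| PSucc : prf
| PId : prf
| PFst : prf
| PSnd : prf
| PPair : prf -> prf -> prf
| PComp : prf -> prf -> prf
| PRec : prf -> prf -> prf
| PMin : prf -> prf.

Inductive prf_eval : prf -> nat -> nat -> Prop :=
| ev_zero x : prf_eval PZero x 0
| ev_succ x : prf_eval PSucc x (S x)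
| ev_id x : prf_eval PId x x
| ev_fst x y : prf_eval PFst (cpair x y) x
| ev_snd x y : prf_eval PSnd (cpair x y) y
| ev_pair f g x a b :
    prf_eval f x a -> prf_eval g x b -> prf_eval (PPair f g) x (cpair a b)
| ev_comp f g x a b :
    prf_eval g x a -> prf_eval f a b -> prf_eval (PComp f g) x b
| ev_rec0 f g x a :
    prf_eval f x a -> prf_eval (PRec f g) (cpair x 0) a
| ev_recS f g x n a b :
    prf_eval (PRec f g) (cpair x n) a ->
    prf_eval g (cpair x (cpair n a)) b ->
    prf_eval (PRec f g) (cpair x (S n)) b
| ev_min f x n :
    prf_eval f (cpair x n) 0 ->
    (forall m, (m < n)%nat -> exists k, prf_eval f (cpair x m) (S k)) ->
    prf_eval (PMin f) x n.

Definition computable1 (f : nat -> nat) : Prop :=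
  exists c, forall x, prf_eval c x (f x).
Definition computable2 (f : nat -> nat -> nat) : Prop :=
  exists c, forall x y, prf_eval c (cpair x y) (f x y).

Definition ce (A : nat -> Prop) : Prop :=
  exists c, forall n, A n <-> exists y, prf_eval c n y.

Definition ratcode (a b c : nat) : R := (INR a - INR b) / (INR c + 1).

Definition computable_rat_seq (q : nat -> R) : Prop :=
  exists A B C, computable1 A /\ computable1 B /\ computable1 C /\
    forall i, q i = ratcode (A i) (B i) (C i).

Definition computable_real_fun2 (g : nat -> nat -> R) : Prop :=
  exists cA cB cC, forall i j k, exists a b c,
    prf_eval cA (cpair (cpair i j) k) a /\
    prf_eval cB (cpair (cpair i j) k) b /\
    prf_eval cC (cpair (cpair i j) k) c /\
    Rabs (g i j - ratcode a b c) < / 2 ^ k.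

Definition is_rational (r : R) : Prop :=
  exists (p : Z) (m : nat), (0 < m)%nat /\ r = IZR p / INR m.

Definition is_metric {X : Type} (d : X -> X -> R) : Prop :=
  (forall x y, 0 <= d x y) /\
  (forall x y, d x y = 0 <-> x = y) /\
  (forall x y, d x y = d y x) /\
  (forall x y z, d x z <= d x y + d y z).

Definition open_set {X : Type} (d : X -> X -> R) (U : X -> Prop) : Prop :=
  forall x, U x -> exists r, 0 < r /\ forall y, d x y < r -> U y.

Definition compact_set {X : Type} (d : X -> X -> R) (K : X -> Prop) : Prop :=
  forall F : (X -> Prop) -> Prop,
    (forall U, F U -> open_set d U) ->
    (forall x, K x -> exists U, F U /\ U x) ->
    exists l : list (X -> Prop), Forall F l /\
      (forall x, K x -> exists U, In U l /\ U x).

Definition computable_metric_space {X : Type} (d : X -> X -> R) (alpha : nat -> X)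
  : Prop :=
  is_metric d /\
  (forall x eps, 0 < eps -> exists i, d x (alpha i) < eps) /\
  computable_real_fun2 (fun i j => d (alpha i) (alpha j)).

Definition valid_enums (q : nat -> R) (tau1 tau2 : nat -> nat)
  (sigma : nat -> nat -> nat) (eta : nat -> nat) : Prop :=
  computable_rat_seq q /\
  (forall r, (exists i, q i = r) <-> (0 < r /\ is_rational r)) /\
  computable1 tau1 /\ computable1 tau2 /\
  (forall a b, exists i, tau1 i = a /\ tau2 i = b) /\
  computable2 sigma /\ computable1 eta /\
  (forall l : list nat, l <> nil ->
     exists j, length l = S (eta j) /\
       forall i, (i < length l)%nat -> nth i l 0%nat = sigma j i).

Section Balls.
Context {X : Type} (d : X -> X -> R) (alpha : nat -> X) (q : nat -> R)
  (tau1 tau2 : nat -> nat) (sigma : nat -> nat -> nat) (eta : nat -> nat).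

Definition lam (i : nat) : X := alpha (tau1 i).
Definition rho (i : nat) : R := q (tau2 i).
Definition Iball (i : nat) (x : X) : Prop := d x (lam i) < rho i.
Definition Junion (j : nat) (x : X) : Prop :=
  exists i, (i <= eta j)%nat /\ Iball (sigma j i) x.

Definition semi_computable_compact (K : X -> Prop) : Prop :=
  compact_set d K /\ ce (fun j => forall x, K x -> Junion j x).

Definition computable_compact (K : X -> Prop) : Prop :=
  semi_computable_compact K /\ ce (fun i => exists x, K x /\ Iball i x).
End Balls.

(* R^n realised as the vectors v : nat -> R with v i = 0 for i >= n,
   with the (max-norm) topology of R^n. *)
Definition Rn (n : nat) (v : nat -> R) : Prop := forall i, (n <= i)%nat -> v i = 0.

Definition homeomorphic_to_Rn {X : Type} (d : X -> X -> R) (N : X -> Prop) (n : nat)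
  : Prop :=
  exists (f : X -> (nat -> R)) (g : (nat -> R) -> X),
    (forall x, N x -> Rn n (f x)) /\
    (forall v, Rn n v -> N (g v)) /\
    (forall x, N x -> g (f x) = x) /\
    (forall v, Rn n v -> f (g v) = v) /\
    (forall x eps, N x -> 0 < eps -> exists del, 0 < del /\
       forall y, N y -> d x y < del ->
         forall i, (i < n)%nat -> Rabs (f x i - f y i) < eps) /\
    (forall v eps, Rn n v -> 0 < eps -> exists del, 0 < del /\
       forall w, Rn n w -> (forall i, (i < n)%nat -> Rabs (v i - w i) < del) ->
         d (g v) (g w) < eps).

Definition is_manifold {X : Type} (d : X -> X -> R) (S : X -> Prop) : Prop :=
  (exists x, S x) /\
  exists n, (1 <= n)%nat /\
    forall x, S x -> exists N : X -> Prop,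
      (forall y, N y -> S y) /\
      (exists U, open_set d U /\ U x /\ forall y, U y -> S y -> N y) /\
      homeomorphic_to_Rn d N n.

(* Main.v *)
(* S meets the rational ball I exactly when a finite certificate exists.  Around a point
   of S take a cube in a chart; its faces, and the part of S outside a larger cube, are
   covered once and for all by finitely many rational balls.  A certificate is a finite
   cover of S consisting of these balls, of I, and of further balls each assigned to the
   lower or the upper side of some coordinate, such that balls on opposite sides of the
   same coordinate are formally disjoint, which is semi-decidable.  If I contains a point
   of S near the centre, certificates exist: the points of the larger cube not in I differ
   from it noticeably in some coordinate.  Conversely, if S missed I, the cube would be
   covered by 2n sets, opposite ones being at positive distance and the i-th pair
   containing the i-th pair of opposite faces; this contradicts Kuhn's cubical Sperner
   lemma, which follows from Stokes' theorem for cubical cochains mod 2.  By compactness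
   finitely many cubes suffice, and S meets I iff one of the corresponding c.e. sets of
   balls with a certificate contains I. *)

From Stdlib Require Import Reals List Permutation Bool Arith Lia Lra Cantor.
From Stdlib Require Import Classical ClassicalEpsilon FunctionalExtensionality.
Require Import Defs.
Import ListNotations.
Local Open Scope nat_scope.

(** * Recursive and recursively enumerable predicates *)

(** Identifies the coding with the library's Cantor bijection, whose inverse supplies the
    projections. *)
Lemma cpair_to_nat x y : cpair x y = to_nat (x, y).
Proof.
  unfold cpair.
  pose proof (to_nat_spec x y) as H.
  pose proof (to_nat_non_decreasing x y) as H'.
  replace ((x + y) * (x + y + 1)) with ((to_nat (x, y) - y) * 2).
  - rewrite Nat.div_mul by lia. lia.
  - rewrite Nat.mul_sub_distr_r, H.
    replace (y + x) with (x + y) by lia.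
    replace (x + y + 1) with (S (x + y)) by lia. lia.
Qed.

Definition pi1 (n : nat) : nat := fst (of_nat n).
Definition pi2 (n : nat) : nat := snd (of_nat n).

Lemma pi1_cpair x y : pi1 (cpair x y) = x.
Proof. unfold pi1. now rewrite cpair_to_nat, cancel_of_to. Qed.

Lemma pi2_cpair x y : pi2 (cpair x y) = y.
Proof. unfold pi2. now rewrite cpair_to_nat, cancel_of_to. Qed.

Lemma cpair_pi n : cpair (pi1 n) (pi2 n) = n.
Proof.
  unfold pi1, pi2. rewrite cpair_to_nat, <- surjective_pairing. apply cancel_to_of.
Qed.

Lemma cpair_inj x y x' y' : cpair x y = cpair x' y' -> x = x' /\ y = y'.
Proof.
  intro H. split.
  - rewrite <- (pi1_cpair x y), H. apply pi1_cpair.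
  - rewrite <- (pi2_cpair x y), H. apply pi2_cpair.
Qed.

(** * Closure properties of total computable functions *)

Lemma computable1_ext f g :
  (forall n, f n = g n) -> computable1 f -> computable1 g.
Proof. intros E [c H]. exists c. intro n. rewrite <- E. apply H. Qed.

Lemma computable1_id : computable1 (fun n => n).
Proof. exists PId. constructor. Qed.

Lemma computable1_comp f g :
  computable1 f -> computable1 g -> computable1 (fun n => f (g n)).
Proof. intros [c H] [c' H']. exists (PComp c c'). intro n. econstructor; eauto. Qed.

Lemma computable1_S : computable1 S.
Proof. exists PSucc. constructor. Qed.

Lemma computable1_const k : computable1 (fun _ => k).
Proof.
  induction k as [|k IH].
  - exists PZero. constructor.
  - exact (computable1_comp S (fun _ => k) computable1_S IH).
Qed.

Lemma computable1_pi1 : computable1 pi1.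
Proof. exists PFst. intro n. rewrite <- (cpair_pi n) at 1. constructor. Qed.

Lemma computable1_pi2 : computable1 pi2.
Proof. exists PSnd. intro n. rewrite <- (cpair_pi n) at 1. constructor. Qed.

Lemma computable1_pair f g :
  computable1 f -> computable1 g -> computable1 (fun n => cpair (f n) (g n)).
Proof. intros [c H] [c' H']. exists (PPair c c'). intro n. constructor; auto. Qed.

(** Functions of two arguments are treated as unary functions of a Cantor code, so that the single
    predicate [computable1] suffices. *)
Lemma computable1_comp2 f u v :
  computable1 (fun p => f (pi1 p) (pi2 p)) -> computable1 u -> computable1 v ->
  computable1 (fun n => f (u n) (v n)).
Proof.
  intros Hf Hu Hv.
  refine (computable1_ext _ _ _ (computable1_comp _ _ Hf (computable1_pair _ _ Hu Hv))).
  intro n. cbv beta. now rewrite pi1_cpair, pi2_cpair.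
Qed.

Lemma computable2_uncurry f :
  computable2 f -> computable1 (fun p => f (pi1 p) (pi2 p)).
Proof. intros [c H]. exists c. intro n. rewrite <- (cpair_pi n) at 1. apply H. Qed.

(** Named, like [ifz] below, so that [computability] can recognise it syntactically. *)
Definition nrec (b : nat) (h : nat -> nat -> nat) (n : nat) : nat :=
  nat_rect (fun _ => nat) b h n.

Lemma computable1_nrec b h c :
  computable1 b ->
  computable1 (fun p => h (pi1 p) (pi1 (pi2 p)) (pi2 (pi2 p))) ->
  computable1 c ->
  computable1 (fun n => nrec (b n) (h n) (c n)).
Proof.
  intros [cb Hb] [ch Hh] Hc.
  apply (computable1_comp2 (fun n k => nrec (b n) (h n) k) (fun n => n) c);
    [|apply computable1_id|exact Hc].
  exists (PRec cb ch). intro p. rewrite <- (cpair_pi p) at 1.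
  generalize (pi1 p) (pi2 p). clear p. intros n k.
  induction k as [|k IH]; simpl.
  - constructor. apply Hb.
  - econstructor; [exact IH|].
    specialize (Hh (cpair n (cpair k (nrec (b n) (h n) k)))).
    rewrite !pi2_cpair, !pi1_cpair in Hh. exact Hh.
Qed.

Definition ifz (a b c : nat) : nat := match a with 0 => b | S _ => c end.

Lemma computable1_ifz a b c :
  computable1 a -> computable1 b -> computable1 c ->
  computable1 (fun n => ifz (a n) (b n) (c n)).
Proof.
  intros Ha Hb Hc.
  apply (computable1_ext (fun n => nrec (b n) (fun _ _ => c n) (a n))).
  - intro n. unfold ifz. now destruct (a n).
  - apply (computable1_nrec b (fun n _ _ => c n) a); try assumption.
    apply (computable1_comp c pi1); [assumption|apply computable1_pi1].
Qed.

Lemma computable1_pred f : computable1 f -> computable1 (fun n => pred (f n)).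
Proof.
  intros Hf.
  apply (computable1_ext (fun n => nrec 0 (fun k _ => k) (f n))).
  - intro n. now destruct (f n).
  - apply (computable1_nrec (fun _ => 0) (fun _ k _ => k)); trivial.
    + apply computable1_const.
    + apply (computable1_comp pi1 pi2); [apply computable1_pi1|apply computable1_pi2].
Qed.

Lemma computable1_acc : computable1 (fun p => pi2 (pi2 p)).
Proof. apply (computable1_comp pi2 pi2); apply computable1_pi2. Qed.

Lemma computable1_add u v :
  computable1 u -> computable1 v -> computable1 (fun n => u n + v n).
Proof.
  intros Hu Hv.
  apply (computable1_ext (fun n => nrec (u n) (fun _ a => S a) (v n))).
  - intro n. generalize (v n). induction n0 as [|k IH]; simpl; lia.
  - apply (computable1_nrec u (fun _ _ a => S a)); trivial.
    apply (computable1_comp S); [apply computable1_S|apply computable1_acc].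
Qed.

Lemma computable1_sub u v :
  computable1 u -> computable1 v -> computable1 (fun n => u n - v n).
Proof.
  intros Hu Hv.
  apply (computable1_ext (fun n => nrec (u n) (fun _ a => pred a) (v n))).
  - intro n. generalize (v n). induction n0 as [|k IH]; simpl; lia.
  - apply (computable1_nrec u (fun _ _ a => pred a)); trivial.
    apply computable1_pred, computable1_acc.
Qed.

Lemma computable1_mul u v :
  computable1 u -> computable1 v -> computable1 (fun n => u n * v n).
Proof.
  intros Hu Hv.
  apply (computable1_ext (fun n => nrec 0 (fun _ a => a + u n) (v n))).
  - intro n. generalize (v n). induction n0 as [|k IH]; simpl; lia.
  - apply (computable1_nrec (fun _ => 0) (fun n _ a => a + u n)); trivial.
    + apply computable1_const.
    + apply computable1_add; [apply computable1_acc|].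
      apply (computable1_comp u pi1); [assumption|apply computable1_pi1].
Qed.

Lemma computable1_pow2 u : computable1 u -> computable1 (fun n => 2 ^ u n).
Proof.
  intros Hu.
  apply (computable1_ext (fun n => nrec 1 (fun _ a => a + a) (u n))).
  - intro n. generalize (u n). induction n0 as [|k IH]; simpl; lia.
  - apply (computable1_nrec (fun _ => 1) (fun n _ a => a + a)); trivial.
    + apply computable1_const.
    + apply computable1_add; apply computable1_acc.
Qed.

Ltac computability :=
  repeat match goal with
  | H : computable1 ?f |- computable1 ?f => exact H
  | |- computable1 (fun n => n) => apply computable1_id
  | |- computable1 (fun _ => ?k) => apply computable1_const
  | |- computable1 pi1 => apply computable1_pi1
  | |- computable1 pi2 => apply computable1_pi2
  | |- computable1 (fun n => pi1 (@?u n)) =>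
      apply (computable1_comp pi1 u); [apply computable1_pi1|]
  | |- computable1 (fun n => pi2 (@?u n)) =>
      apply (computable1_comp pi2 u); [apply computable1_pi2|]
  | |- computable1 (fun n => S (@?u n)) =>
      apply (computable1_comp S u); [apply computable1_S|]
  | |- computable1 (fun n => cpair (@?u n) (@?v n)) => apply (computable1_pair u v)
  | |- computable1 (fun n => pred (@?u n)) => apply (computable1_pred u)
  | |- computable1 (fun n => 2 ^ @?u n) => apply (computable1_pow2 u)
  | |- computable1 (fun n => @?u n + @?v n) => apply (computable1_add u v)
  | |- computable1 (fun n => @?u n - @?v n) => apply (computable1_sub u v)
  | |- computable1 (fun n => @?u n * @?v n) => apply (computable1_mul u v)
  | |- computable1 (fun n => ifz (@?u n) (@?v n) (@?w n)) =>
      apply (computable1_ifz u v w)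
  | |- computable1 (fun n => nrec (@?b n) (@?h n) (@?c n)) =>
      apply (computable1_nrec b h c)
  | H : computable1 ?f |- computable1 (fun n => ?f (@?u n)) =>
      apply (computable1_comp f u H)
  | H : computable1 (fun p => ?f (pi1 p) (pi2 p))
      |- computable1 (fun n => ?f (@?u n) (@?v n)) =>
      apply (computable1_comp2 f u v H)
  end.

(* [steps c x s] is [S y] if the evaluation of [c] at [x], with every unbounded
   search cut off at [s], returns [y], and [0] if it does not terminate. *)
Fixpoint steps (c : prf) (x s : nat) : nat :=
  match c with
  | PZero => 1
  | PSucc => S (S x)
  | PId => S x
  | PFst => S (pi1 x)
  | PSnd => S (pi2 x)
  | PPair f g =>
      ifz (steps f x s) 0
        (ifz (steps g x s) 0 (S (cpair (pred (steps f x s)) (pred (steps g x s)))))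
  | PComp f g => ifz (steps g x s) 0 (steps f (pred (steps g x s)) s)
  | PRec f g =>
      nrec (steps f (pi1 x) s)
        (fun k a => ifz a 0 (steps g (cpair (pi1 x) (cpair k (pred a))) s)) (pi2 x)
  | PMin f =>
      (* 0: still searching; 1: a value below is undefined; k + 2: found k *)
      pred (nrec 0
        (fun k a => ifz a (ifz (steps f (cpair x k) s) 1
                             (ifz (pred (steps f (cpair x k) s)) (S (S k)) 0)) a) s)
  end.

Lemma steps_computable c : computable1 (fun p => steps c (pi1 p) (pi2 p)).
Proof.
  induction c; cbn [steps]; computability.
Qed.

Lemma steps_sound c : forall x s y, steps c x s = S y -> prf_eval c x y.
Proof.
  induction c as [| | | | |f IHf g IHg|f IHf g IHg|f IHf g IHg|f IHf];
    intros x s y; cbn [steps].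
  - intros [= <-]. constructor.
  - intros [= <-]. constructor.
  - intros [= <-]. constructor.
  - intros [= <-]. rewrite <- (cpair_pi x) at 1. constructor.
  - intros [= <-]. rewrite <- (cpair_pi x) at 1. constructor.
  - destruct (steps f x s) as [|a] eqn:Ef; [discriminate|].
    destruct (steps g x s) as [|b] eqn:Eg; [discriminate|].
    intros [= <-]. constructor; eauto.
  - destruct (steps g x s) as [|a] eqn:Eg; [discriminate|].
    simpl. intro E. econstructor; eauto.
  - intro E. rewrite <- (cpair_pi x). revert E.
    generalize (pi1 x) (pi2 x). clear x. intros x n. revert y. induction n as [|n IHn]; intro y; simpl.
    + intro E. constructor. eauto.
    + destruct (nrec _ _ n) as [|a] eqn:Ea; [discriminate|].
      simpl. intro E. econstructor; eauto.
  - set (h := fun k a => _).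
    (* Loop invariant of the search: state 0 certifies that all earlier values are positive, state
       [b + 2] that [b] is the least zero. *)
    assert (Hs : forall k,
      (nrec 0 h k = 0 -> forall m, m < k -> exists b, prf_eval f (cpair x m) (S b)) /\
      (forall b, nrec 0 h k = S (S b) -> prf_eval (PMin f) x b)).
    { induction k as [|k [IH1 IH2]].
      - split; [lia|discriminate].
      - change (nrec 0 h (S k)) with (h k (nrec 0 h k)).
        destruct (nrec 0 h k) as [|a]; unfold h; cbn [ifz].
        + destruct (steps f (cpair x k) s) as [|[|b]] eqn:E; cbn [ifz pred].
          * split; discriminate.
          * split; [discriminate|]. intros b [= <-]. constructor; eauto.
          * split; [|discriminate]. intros _ m Hm.
            destruct (Nat.eq_dec m k) as [->|]; [eauto|apply IH1; lia].
        + split; [discriminate|]. intros b E. eauto. }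
    intro E. apply (Hs s). change (pred (nrec 0 h s) = S y) in E. lia.
Qed.

(** A threshold instead of a single [s] lets the bounds of subcomputations be added. *)
Lemma steps_complete c : forall x y, prf_eval c x y ->
  exists s, forall s', s <= s' -> steps c x s' = S y.
Proof.
  induction c as [| | | | |f IHf g IHg|f IHf g IHg|f IHf g IHg|f IHf];
    intros x y H.
  - inversion H; subst. exists 0. reflexivity.
  - inversion H; subst. exists 0. reflexivity.
  - inversion H; subst. exists 0. reflexivity.
  - inversion H; subst. exists 0. intros; simpl. now rewrite pi1_cpair.
  - inversion H; subst. exists 0. intros; simpl. now rewrite pi2_cpair.
  - inversion H as [| | | | |f' g' x' a b Hf Hg| | | |]; subst.
    destruct (IHf _ _ Hf) as [s1 H1]. destruct (IHg _ _ Hg) as [s2 H2].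
    exists (s1 + s2). intros s Hs. simpl. rewrite H1, H2 by lia. reflexivity.
  - inversion H as [| | | | | |f' g' x' a b Hg Hf| | |]; subst.
    destruct (IHf _ _ Hf) as [s1 H1]. destruct (IHg _ _ Hg) as [s2 H2].
    exists (s1 + s2). intros s Hs. simpl. rewrite H2 by lia. simpl. apply H1. lia.
  - rewrite <- (cpair_pi x) in H. cbn [steps].
    revert H. generalize (pi1 x) (pi2 x). clear x. intros x n. revert y.
    induction n as [|n IHn]; intros y H.
    + inversion H as [| | | | | | |f' g' x' a Hf|f' g' x' m a b Hr Hg|]; subst;
        match goal with
        | E : cpair _ _ = cpair _ _ |- _ => apply cpair_inj in E as [E1 E2]
        end;
        [|discriminate].
      subst. simpl. eauto.
    + inversion H as [| | | | | | |f' g' x' a Hf|f' g' x' m a b Hr Hg|]; subst;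
        match goal with
        | E : cpair _ _ = cpair _ _ |- _ => apply cpair_inj in E as [E1 E2]
        end;
        [discriminate|].
      injection E2 as ->. subst.
      destruct (IHn _ Hr) as [s1 H1]. destruct (IHg _ _ Hg) as [s2 H2].
      exists (s1 + s2). intros s Hs. simpl. rewrite H1 by lia. simpl. apply H2. lia.
  - inversion H as [| | | | | | | | |f' x' n H0 Hlt]; subst.
    destruct (IHf _ _ H0) as [s0 Hs0].
    assert (Hm : forall m, m <= y -> exists s1, forall k s', k < m -> s1 <= s' ->
      exists b, steps f (cpair x k) s' = S (S b)).
    { induction m as [|m IHm]; intro Hy.
      - exists 0. lia.
      - destruct IHm as [s1 Hs1]; [lia|].
        destruct (Hlt m) as [b Hb]; [lia|].
        destruct (IHf _ _ Hb) as [s2 Hs2].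
        exists (s1 + s2). intros k s' Hk Hs'.
        destruct (Nat.eq_dec k m) as [->|].
        + exists b. apply Hs2. lia.
        + apply Hs1; lia. }
    destruct (Hm y (le_n y)) as [s1 Hs1].
    (* The summand [S y] makes the truncated search long enough to inspect [y] itself. *)
    exists (s0 + s1 + S y). intros s Hs. cbn [steps].
    set (h := fun k a => _).
    assert (Hk : forall k, k <= y -> nrec 0 h k = 0).
    { induction k as [|k IHk]; intro Hle; [reflexivity|].
      change (h k (nrec 0 h k) = 0). rewrite IHk by lia. unfold h.
      destruct (Hs1 k s) as [b ->]; [lia|lia|]. reflexivity. }
    (* From stage [S y] on the state is frozen at the answer. *)
    assert (Hl : forall k, nrec 0 h (k + S y) = S (S y)).
    { induction k as [|k IHk].
      - change (h y (nrec 0 h y) = S (S y)). rewrite Hk by lia. unfold h.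
        rewrite Hs0 by lia. reflexivity.
      - change (h (k + S y) (nrec 0 h (k + S y)) = S (S y)). now rewrite IHk. }
    replace s with (s - S y + S y) by lia.
    now rewrite Hl.
Qed.

(** * Closure properties of recursively enumerable predicates *)

(** Normal form with a total matrix, zero meaning truth: logical connectives become arithmetic, and
    no partial function has to be handled. *)
Definition re (A : nat -> Prop) : Prop :=
  exists f, computable1 f /\ forall n, A n <-> exists k, f (cpair n k) = 0.

Lemma ce_re A : ce A -> re A.
Proof.
  intros [c Hc]. exists (fun p => 1 - steps c (pi1 p) (pi2 p)). split.
  - pose proof (steps_computable c). computability.
  - intro n. rewrite Hc. split.
    + intros [y Hy]. destruct (steps_complete _ _ _ Hy) as [s Hs].
      exists s. rewrite pi1_cpair, pi2_cpair, Hs; lia.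
    + intros [s Hs]. rewrite pi1_cpair, pi2_cpair in Hs.
      destruct (steps c n s) as [|y] eqn:E; [lia|].
      exists y. eapply steps_sound; eauto.
Qed.

Lemma re_ce A : re A -> ce A.
Proof.
  intros [f [[c Hc] Hf]]. exists (PMin c). intro n. rewrite Hf. split.
  - intros [k Hk].
    (* The rule [ev_min] needs the least zero, not just some zero. *)
    assert (Hmin : exists m, f (cpair n m) = 0 /\
      forall m', m' < m -> f (cpair n m') <> 0).
    { induction k as [k IH] using lt_wf_ind.
      destruct (classic (exists m, m < k /\ f (cpair n m) = 0)) as [[m [Hm E]]|Hno].
      - eauto.
      - exists k. split; [exact Hk|]. intros m' Hm' E. eauto. }
    destruct Hmin as [m [Hm Hlt]]. exists m. constructor.
    + rewrite <- Hm. apply Hc.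
    + intros m' Hm'. exists (pred (f (cpair n m'))).
      specialize (Hlt m' Hm'). replace (S _) with (f (cpair n m')) by lia. apply Hc.
  - intros [y Hy]. inversion Hy as [| | | | | | | | |f' x' m H0 Hlt]; subst.
    exists y.
    (* Evaluation is deterministic: both results are read off from [steps] at one common bound. *)
    destruct (steps_complete _ _ _ H0) as [s Hs].
    destruct (steps_complete _ _ _ (Hc (cpair n y))) as [s' Hs'].
    specialize (Hs (s + s')). specialize (Hs' (s + s')). lia.
Qed.

Lemma re_ext A B : (forall n, A n <-> B n) -> re A -> re B.
Proof.
  intros E [f [Hf H]]. exists f. split; [exact Hf|]. intro n. now rewrite <- E.
Qed.

Lemma re_comp A u : re A -> computable1 u -> re (fun n => A (u n)).
Proof.
  intros [f [Hf H]] Hu. exists (fun p => f (cpair (u (pi1 p)) (pi2 p))). split.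
  - computability.
  - intro n. rewrite H. split; intros [k E]; exists k;
      rewrite pi1_cpair, pi2_cpair in *; exact E.
Qed.

Lemma re_comp2 A u v :
  re (fun p => A (pi1 p) (pi2 p)) -> computable1 u -> computable1 v ->
  re (fun n => A (u n) (v n)).
Proof.
  intros H Hu Hv.
  refine (re_ext _ _ _ (re_comp _ _ H (computable1_pair _ _ Hu Hv))).
  intro n. cbv beta. now rewrite pi1_cpair, pi2_cpair.
Qed.

Lemma re_zero f : computable1 f -> re (fun n => f n = 0).
Proof.
  intro Hf. exists (fun p => f (pi1 p)). split; [computability|].
  intro n. split.
  - intro E. exists 0. now rewrite pi1_cpair.
  - intros [k E]. now rewrite pi1_cpair in E.
Qed.

Lemma re_true : re (fun _ => True).
Proof.
  apply (re_ext (fun _ => 0 = 0)); [tauto|].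
  apply (re_zero (fun _ => 0)). computability.
Qed.

Lemma re_false : re (fun _ => False).
Proof.
  apply (re_ext (fun _ => 1 = 0)); [intuition discriminate|].
  apply (re_zero (fun _ => 1)). computability.
Qed.

Lemma re_ex (A : nat -> nat -> Prop) :
  re (fun p => A (pi1 p) (pi2 p)) -> re (fun n => exists m, A n m).
Proof.
  intros [f [Hf H]].
  exists (fun p => f (cpair (cpair (pi1 p) (pi1 (pi2 p))) (pi2 (pi2 p)))). split.
  - computability.
  - intro n. split.
    + intros [m Hm]. specialize (H (cpair n m)).
      rewrite pi1_cpair, pi2_cpair in H. apply H in Hm as [k Hk].
      exists (cpair m k). now rewrite !pi2_cpair, !pi1_cpair.
    + intros [k Hk]. rewrite pi2_cpair, pi1_cpair in Hk.
      exists (pi1 k). specialize (H (cpair n (pi1 k))).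
      rewrite pi1_cpair, pi2_cpair in H. apply H. eauto.
Qed.

Lemma re_or A B : re A -> re B -> re (fun n => A n \/ B n).
Proof.
  intros [f [Hf HA]] [g [Hg HB]]. exists (fun p => f p * g p). split.
  - computability.
  - intro n. rewrite HA, HB. split.
    + intros [[k E]|[k E]]; exists k; rewrite E; lia.
    + intros [k E]. apply Nat.eq_mul_0 in E as [E|E]; eauto.
Qed.

Definition bsum (h : nat -> nat) (n : nat) : nat := nrec 0 (fun k a => a + h k) n.
Definition bprod (h : nat -> nat) (n : nat) : nat := nrec 1 (fun k a => a * h k) n.

Lemma bsum_zero h n : bsum h n = 0 <-> forall k, k < n -> h k = 0.
Proof.
  unfold bsum. induction n as [|n IH]; simpl.
  - split; [lia|reflexivity].
  - rewrite Nat.eq_add_0, IH. split.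
    + intros [H E] k Hk. destruct (Nat.eq_dec k n) as [->|]; auto with arith.
      apply H. lia.
    + intro H. split; [intros k Hk|]; apply H; lia.
Qed.

Lemma bprod_zero h n : bprod h n = 0 <-> exists k, k < n /\ h k = 0.
Proof.
  unfold bprod. induction n as [|n IH]; simpl.
  - split; [discriminate|intros [k [Hk _]]; lia].
  - rewrite Nat.eq_mul_0, IH. split.
    + intros [[k [Hk E]]|E]; [exists k|exists n]; split; auto; lia.
    + intros [k [Hk E]]. destruct (Nat.eq_dec k n) as [->|]; auto.
      left. exists k. split; auto. lia.
Qed.

(** One number bounds the witnesses of the finitely many [m]; a sum of products then tests whether
    each [m] has a witness below that bound. *)
Lemma re_bounded_all (b : nat -> nat) (A : nat -> nat -> Prop) :
  computable1 b -> re (fun p => A (pi1 p) (pi2 p)) ->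
  re (fun n => forall m, m <= b n -> A n m).
Proof.
  intros Hb [f [Hf H]].
  exists (fun p => bsum (fun m => bprod (fun k => f (cpair (cpair (pi1 p) m) k))
            (S (pi2 p))) (S (b (pi1 p)))).
  split.
  - unfold bsum, bprod. computability.
  - intro n. split.
    + intro HA.
      assert (HK : forall N, N <= S (b n) -> exists K, forall m, m < N ->
        exists k, k < S K /\ f (cpair (cpair n m) k) = 0).
      { induction N as [|N IH]; intro HN.
        - exists 0. lia.
        - destruct IH as [K HK]; [lia|].
          specialize (HA N ltac:(lia)). specialize (H (cpair n N)).
          rewrite pi1_cpair, pi2_cpair in H. apply H in HA as [k Hk].
          exists (K + k). intros m Hm. destruct (Nat.eq_dec m N) as [->|].
          + exists k. split; [lia|exact Hk].
          + destruct (HK m) as [k' [Hk' E]]; [lia|]. exists k'. split; [lia|exact E]. }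
      destruct (HK _ (le_n _)) as [K HK'].
      exists K. rewrite pi1_cpair, pi2_cpair. apply bsum_zero.
      intros m Hm. apply bprod_zero. auto.
    + intros [K HK] m Hm. rewrite pi1_cpair, pi2_cpair, bsum_zero in HK.
      specialize (HK m ltac:(lia)). apply bprod_zero in HK as [k [_ Hk]].
      specialize (H (cpair n m)). rewrite pi1_cpair, pi2_cpair in H. apply H. eauto.
Qed.

(** Conjunction is a universal quantifier over two indices, so [re_bounded_all] merges the two
    witnesses. *)
Lemma re_and A B : re A -> re B -> re (fun n => A n /\ B n).
Proof.
  intros HA HB.
  apply (re_ext (fun n => forall m, m <= 1 -> m = 0 /\ A n \/ m = 1 /\ B n)).
  - intro n. split.
    + intro H. split.
      * destruct (H 0) as [[_ HA']|[E _]]; [lia|exact HA'|discriminate].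
      * destruct (H 1) as [[E _]|[_ HB']]; [lia|discriminate|exact HB'].
    + intros [HA' HB'] [|[|m]] Hm; auto; lia.
  - apply (re_bounded_all (fun _ => 1)); [computability|].
    destruct HA as [f [Hf HA]], HB as [g [Hg HB]].
    exists (fun p => (pi2 (pi1 p) + f (cpair (pi1 (pi1 p)) (pi2 p))) *
      ((pi2 (pi1 p) - 1) + (1 - pi2 (pi1 p)) + g (cpair (pi1 (pi1 p)) (pi2 p)))).
    split; [computability|].
    intro p. rewrite HA, HB. split.
    + intros [[E [k Hk]]|[E [k Hk]]]; exists k;
        rewrite !pi1_cpair, !pi2_cpair, E, Hk; lia.
    + intros [k E]. rewrite !pi1_cpair, !pi2_cpair in E.
      apply Nat.eq_mul_0 in E as [E|E].
      * left. split; [lia|]. exists k. lia.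
      * right. split; [lia|]. exists k. lia.
Qed.

Lemma re_all_lt (N : nat) (A : nat -> nat -> Prop) :
  (forall k, k < N -> re (A k)) -> re (fun n => forall k, k < N -> A k n).
Proof.
  induction N as [|N IH]; intro H.
  - apply (re_ext (fun _ => True)); [|apply re_true]. intro n. split; [lia|trivial].
  - apply (re_ext (fun n => (forall k, k < N -> A k n) /\ A N n)).
    + intro n. split.
      * intros [H1 H2] k Hk. destruct (Nat.eq_dec k N) as [->|]; auto.
        apply H1. lia.
      * auto.
    + apply re_and; auto.
Qed.

Lemma re_ex_in {T : Type} (l : list T) (A : T -> nat -> Prop) :
  (forall t, In t l -> re (A t)) -> re (fun n => exists t, In t l /\ A t n).
Proof.
  induction l as [|t l IH]; intro H.
  - apply (re_ext (fun _ => False)); [|apply re_false]. intro n. split; [tauto|].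
    intros [t [[] _]].
  - apply (re_ext (fun n => A t n \/ exists t', In t' l /\ A t' n)).
    + intro n. split.
      * intros [H1|[t' [H1 H2]]]; [exists t|exists t']; simpl; auto.
      * intros [t' [[<-|H1] H2]]; eauto.
    + apply re_or; [|apply IH; intros]; apply H; simpl; auto.
Qed.

Definition decidable (A : nat -> Prop) : Prop :=
  exists f, computable1 f /\ forall n, A n <-> f n = 0.

Lemma decidable_eq u v :
  computable1 u -> computable1 v -> decidable (fun n => u n = v n).
Proof.
  intros Hu Hv. exists (fun n => (u n - v n) + (v n - u n)).
  split; [computability|]. intro n. lia.
Qed.

Lemma decidable_lt u v :
  computable1 u -> computable1 v -> decidable (fun n => u n < v n).
Proof.
  intros Hu Hv. exists (fun n => S (u n) - v n). split; [computability|].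
  intro n. lia.
Qed.

Lemma decidable_and A B : decidable A -> decidable B -> decidable (fun n => A n /\ B n).
Proof.
  intros [f [Hf HA]] [g [Hg HB]]. exists (fun n => f n + g n).
  split; [computability|]. intro n. rewrite HA, HB. lia.
Qed.

Lemma decidable_re A : decidable A -> re A.
Proof.
  intros [f [Hf H]]. apply (re_ext (fun n => f n = 0)); [|now apply re_zero].
  intro n. now rewrite H.
Qed.

(** The premise is decidable, so its negation is again enumerable. *)
Lemma re_impl A B : decidable A -> re B -> re (fun n => A n -> B n).
Proof.
  intros [f [Hf HA]] HB. apply (re_ext (fun n => 1 - f n = 0 \/ B n)).
  - intro n. rewrite HA. split.
    + intros [H|H]; [lia|auto].
    + intro H. destruct (f n); [right; auto|left; lia].
  - apply re_or; [apply re_zero; computability|exact HB].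
Qed.

(** * Kuhn's lemma *)

(** Summation in the field with two elements; working mod 2 avoids signs and orientations. *)
Definition xsum {A : Type} (f : A -> bool) (l : list A) : bool :=
  fold_right (fun x acc => xorb (f x) acc) false l.

Lemma xsum_ext {A} (f g : A -> bool) l :
  (forall x, In x l -> f x = g x) -> xsum f l = xsum g l.
Proof.
  induction l as [|x l IH]; intro H; simpl; [reflexivity|].
  rewrite H, IH; simpl; auto. intros; apply H; simpl; auto.
Qed.

Lemma xsum_xorb {A} (f g : A -> bool) l :
  xsum (fun x => xorb (f x) (g x)) l = xorb (xsum f l) (xsum g l).
Proof.
  induction l as [|x l IH]; simpl; [reflexivity|]. rewrite IH.
  destruct (f x), (g x), (xsum f l), (xsum g l); reflexivity.
Qed.

Lemma xsum_false {A} (f : A -> bool) l :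
  (forall x, In x l -> f x = false) -> xsum f l = false.
Proof.
  induction l as [|x l IH]; intro H; simpl; [reflexivity|].
  rewrite H, IH; simpl; auto. intros; apply H; simpl; auto.
Qed.

Lemma xsum_true {A} (f : A -> bool) l :
  xsum f l = true -> exists x, In x l /\ f x = true.
Proof.
  induction l as [|x l IH]; simpl; [discriminate|].
  destruct (f x) eqn:E.
  - intros _. exists x. auto.
  - simpl. intro H. destruct (IH H) as [y [Hy Ey]]. exists y. auto.
Qed.

Lemma xsum_map {A B} (f : B -> bool) (g : A -> B) l :
  xsum f (map g l) = xsum (fun x => f (g x)) l.
Proof. induction l as [|x l IH]; simpl; [reflexivity|]. now rewrite IH. Qed.

Lemma xsum_comm {A B} (f : A -> B -> bool) l m :
  xsum (fun x => xsum (f x) m) l = xsum (fun y => xsum (fun x => f x y) l) m.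
Proof.
  induction l as [|x l IH]; simpl.
  - symmetry. now apply xsum_false.
  - rewrite IH. now rewrite xsum_xorb.
Qed.

Lemma xsum_telescope (f : nat -> bool) M :
  xsum (fun t => xorb (f t) (f (S t))) (seq 0 M) = xorb (f 0) (f M).
Proof.
  assert (H : forall a, xsum (fun t => xorb (f t) (f (S t))) (seq a M)
                        = xorb (f a) (f (a + M))).
  { induction M as [|M IH]; intro a; simpl.
    - rewrite Nat.add_0_r. now destruct (f a).
    - rewrite IH. replace (a + S M) with (S a + M) by lia.
      destruct (f a), (f (S a)), (f (S a + M)); reflexivity. }
  apply (H 0).
Qed.

(** * Cubical cochains mod 2 and their products *)

Definition upd (v : nat -> nat) (h t : nat) : nat -> nat :=
  fun k => if k =? h then t else v k.

Definition step (v : nat -> nat) (h : nat) : nat -> nat := upd v h (S (v h)).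

Lemma upd_same v h t : upd v h t h = t.
Proof. unfold upd. now rewrite Nat.eqb_refl. Qed.

Lemma upd_other v h t k : k <> h -> upd v h t k = v k.
Proof. intro H. unfold upd. apply Nat.eqb_neq in H. now rewrite H. Qed.

Lemma upd_comm v h t k u : h <> k -> upd (upd v h t) k u = upd (upd v k u) h t.
Proof.
  intro H. apply functional_extensionality. intro i. unfold upd.
  destruct (Nat.eqb_spec i k), (Nat.eqb_spec i h); congruence.
Qed.

Lemma step_comm v h k : step (step v h) k = step (step v k) h.
Proof.
  apply functional_extensionality. intro i. unfold step, upd.
  destruct (Nat.eqb_spec k h), (Nat.eqb_spec h k), (Nat.eqb_spec i k),
    (Nat.eqb_spec i h); subst; congruence.
Qed.

Lemma step_upd_same v h t : step (upd v h t) h = upd v h (S t).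
Proof.
  apply functional_extensionality. intro i. unfold step, upd.
  rewrite Nat.eqb_refl. now destruct (i =? h).
Qed.

Lemma step_upd_comm v h t k : k <> h -> upd (step v h) k t = step (upd v k t) h.
Proof.
  intro H. unfold step. rewrite upd_comm by auto. now rewrite (upd_other v k t h).
Qed.

(** The remaining directions keep their order, so removing [h] and then [k] leaves the same list as
    removing [k] and then [h]. *)
Fixpoint picks (D : list nat) : list (nat * list nat) :=
  match D with
  | [] => []
  | h :: E => (h, E) :: map (fun p => (fst p, h :: snd p)) (picks E)
  end.

Lemma picks_perm D k E : In (k, E) (picks D) -> Permutation D (k :: E).
Proof.
  revert k E. induction D as [|h D IH]; intros k E; simpl; [tauto|].
  intros [[= <- <-]|H]; [reflexivity|].
  apply in_map_iff in H as [[k' F] [[= <- <-] H]]. cbn [fst snd].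
  apply IH in H. rewrite H. apply perm_swap.
Qed.

Lemma picks_NoDup D k E :
  NoDup D -> In (k, E) (picks D) ->
  In k D /\ ~ In k E /\ NoDup E /\ (forall i, In i E -> In i D).
Proof.
  intros HD H. apply picks_perm in H.
  pose proof (Permutation_NoDup H HD) as HN. apply NoDup_cons_iff in HN as [Hk HE].
  repeat split; auto.
  - apply (Permutation_in k (Permutation_sym H)). simpl. auto.
  - intros i Hi. apply (Permutation_in i (Permutation_sym H)). simpl. auto.
Qed.

(* A mod-2 cochain assigns a bit to each cube, given by its least vertex [v] and
   the list [D] of directions in which it extends. *)
Definition cochain : Type := (nat -> nat) -> list nat -> bool.

Definition delta (phi : cochain) : cochain := fun v D =>
  xsum (fun p => xorb (phi v (snd p)) (phi (step v (fst p)) (snd p))) (picks D).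

(** Each unordered pair of directions is counted twice with equal values, and these cancel mod 2. *)
Lemma xsum_picks_symmetric D (G : nat -> nat -> list nat -> bool) :
  (forall h k F, G h k F = G k h F) ->
  xsum (fun p => xsum (fun r => G (fst p) (fst r) (snd r)) (picks (snd p))) (picks D)
  = false.
Proof.
  revert G. induction D as [|x D IH]; intros G HG; simpl; [reflexivity|].
  rewrite xsum_map. simpl.
  etransitivity.
  - apply f_equal, (xsum_ext _ (fun p => xorb (G x (fst p) (snd p))
      (xsum (fun r => G (fst p) (fst r) (x :: snd r)) (picks (snd p))))).
    intros p _. rewrite xsum_map, HG. reflexivity.
  - rewrite xsum_xorb, (IH (fun h k F => G h k (x :: F))) by auto.
    rewrite xorb_false_r. apply xorb_nilpotent.
Qed.

Lemma delta_delta phi v D : delta (delta phi) v D = false.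
Proof.
  unfold delta at 1.
  rewrite <- (xsum_picks_symmetric D (fun h k F =>
    xorb (xorb (phi v F) (phi (step v k) F))
         (xorb (phi (step v h) F) (phi (step (step v h) k) F)))).
  - apply xsum_ext. intros p _. unfold delta. now rewrite <- xsum_xorb.
  - intros h k F. rewrite (step_comm v h k).
    destruct (phi v F), (phi (step v k) F), (phi (step v h) F),
      (phi (step (step v k) h) F); reflexivity.
Qed.

(* The iterated cup product of the coboundaries of the 0-cochains in [ss]; since
   coboundaries are closed it is itself the coboundary of [s * wedge ss]. *)
Fixpoint wedge (ss : list ((nat -> nat) -> bool)) : cochain :=
  match ss with
  | [] => fun _ _ => true
  | s :: ss => delta (fun v D => s v && wedge ss v D)
  end.

Lemma delta_wedge ss v D : delta (wedge ss) v D = false.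
Proof.
  destruct ss as [|s ss]; [|apply delta_delta].
  apply xsum_false. reflexivity.
Qed.

(** The Leibniz rule for the coboundary of [s * wedge ss]; the term with [delta (wedge ss)] vanishes
    by closedness. *)
Lemma wedge_cons s ss v D :
  wedge (s :: ss) v D =
  xsum (fun p => xorb (s v) (s (step v (fst p))) && wedge ss (step v (fst p)) (snd p))
    (picks D).
Proof.
  cbn [wedge]. unfold delta at 1.
  transitivity (xorb (s v && delta (wedge ss) v D) (xsum (fun p =>
    xorb (s v) (s (step v (fst p))) && wedge ss (step v (fst p)) (snd p)) (picks D))).
  - unfold delta. destruct (s v); cbn [andb].
    + rewrite <- xsum_xorb. apply xsum_ext. intros p _.
      destruct (wedge ss v (snd p)), (s (step v (fst p))),
        (wedge ss (step v (fst p)) (snd p)); reflexivity.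
    + rewrite xorb_false_l. apply xsum_ext. intros p _.
      now rewrite xorb_false_l.
  - rewrite delta_wedge, andb_false_r. apply xorb_false_l.
Qed.

Definition in_cube (v : nat -> nat) (D : list nat) (u : nat -> nat) : Prop :=
  forall k, u k = v k \/ In k D /\ u k = S (v k).

(** By [wedge_cons] a nonzero product has a nonzero term: the first factor changes along an edge of
    the cube, and the other factors live on the face beyond that edge. *)
Lemma wedge_local ss : forall v D, NoDup D -> wedge ss v D = true ->
  forall s, In s ss -> exists u u', in_cube v D u /\ in_cube v D u' /\ s u <> s u'.
Proof.
  induction ss as [|s0 ss IH]; intros v D HD HW s Hs; [destruct Hs|].
  rewrite wedge_cons in HW. apply xsum_true in HW as [[h E] [HhE HW]].
  apply andb_prop in HW as [Hx HW]. cbn [fst snd] in *.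
  destruct (picks_NoDup _ _ _ HD HhE) as [Hh [HhnE [HE Hincl]]].
  destruct Hs as [->|Hs].
  - exists v, (step v h). split; [|split].
    + intro k. auto.
    + intro k. unfold step, upd. destruct (Nat.eqb_spec k h) as [->|]; auto.
    + intro E'. rewrite E' in Hx. now rewrite xorb_nilpotent in Hx.
  - assert (Hc : forall u, in_cube (step v h) E u -> in_cube v D u).
    { intros u Hu k. specialize (Hu k). unfold step, upd in Hu.
      destruct (Nat.eqb_spec k h) as [Ek|Ek]; cbv beta in Hu.
      - subst k. right. split; [exact Hh|]. destruct Hu as [Hu|[Hu _]]; [exact Hu|contradiction].
      - destruct Hu as [Hu|[Hk Hu]]; auto. }
    destruct (IH _ _ HE HW s Hs) as [u [u' [H1 [H2 H3]]]].
    exists u, u'. auto.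
Qed.

(** * Summation over grids, Stokes' theorem and Kuhn's lemma *)

(** For [f v = phi v D] this evaluates a cochain on the subdivided box [[0, M]^D] placed at [b]. *)
Fixpoint grid (M : nat) (D : list nat) (f : (nat -> nat) -> bool) (b : nat -> nat) : bool :=
  match D with
  | [] => f b
  | h :: E => xsum (fun t => grid M E f (upd b h t)) (seq 0 M)
  end.

Definition in_grid (M : nat) (D : list nat) (b v : nat -> nat) : Prop :=
  (forall k, In k D -> v k < M) /\ (forall k, ~ In k D -> v k = b k).

Lemma in_grid_upd M h E b t v :
  ~ In h E -> t < M -> in_grid M E (upd b h t) v -> in_grid M (h :: E) b v.
Proof.
  intros Hh Ht [H1 H2]. split.
  - intros k [<-|Hk]; auto. rewrite H2, upd_same; auto.
  - intros k Hk. simpl in Hk. rewrite H2 by tauto.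
    apply upd_other. intros ->. tauto.
Qed.

Lemma grid_ext M D f g b : NoDup D ->
  (forall v, in_grid M D b v -> f v = g v) -> grid M D f b = grid M D g b.
Proof.
  revert b. induction D as [|h E IH]; intros b HD H; simpl.
  - apply H. split; simpl; tauto.
  - apply NoDup_cons_iff in HD as [Hh HE].
    apply xsum_ext. intros t Ht. apply in_seq in Ht.
    apply IH; [exact HE|]. intros v Hv. apply H.
    apply (in_grid_upd _ _ _ _ t); auto. lia.
Qed.

Lemma grid_xorb M D f g b :
  grid M D (fun v => xorb (f v) (g v)) b = xorb (grid M D f b) (grid M D g b).
Proof.
  revert b. induction D as [|h E IH]; intro b; simpl; [reflexivity|].
  rewrite <- xsum_xorb. apply xsum_ext. auto.
Qed.

Lemma grid_false M D b : grid M D (fun _ => false) b = false.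
Proof.
  revert b. induction D as [|h E IH]; intro b; simpl; [reflexivity|].
  apply xsum_false. auto.
Qed.

Lemma grid_true M D f b : NoDup D ->
  grid M D f b = true -> exists v, in_grid M D b v /\ f v = true.
Proof.
  revert b. induction D as [|h E IH]; intros b HD; simpl.
  - intro H. exists b. repeat split; simpl; tauto.
  - apply NoDup_cons_iff in HD as [Hh HE]. intro H.
    apply xsum_true in H as [t [Ht H]]. apply in_seq in Ht.
    destruct (IH _ HE H) as [v [Hv Hf]]. exists v. split; [|exact Hf].
    apply (in_grid_upd _ _ _ _ t); auto. lia.
Qed.

Lemma grid_step M E f b h :
  ~ In h E -> grid M E (fun v => f (step v h)) b = grid M E f (step b h).
Proof.
  revert b. induction E as [|k E IH]; intros b Hh; simpl; [reflexivity|].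
  simpl in Hh. apply xsum_ext. intros t _.
  rewrite IH, step_upd_comm by tauto. reflexivity.
Qed.

(** Induction on the directions. For the first direction [h] the face terms telescope; the other
    terms form a coboundary within each slice orthogonal to [h], and the slices are summed up
    again. *)
Lemma stokes M D phi b : NoDup D ->
  grid M D (fun v => delta phi v D) b =
  xsum (fun p => xorb (grid M (snd p) (fun v => phi v (snd p)) (upd b (fst p) 0))
                      (grid M (snd p) (fun v => phi v (snd p)) (upd b (fst p) M)))
    (picks D).
Proof.
  revert phi b. induction D as [|h E IH]; intros phi b HD; [reflexivity|].
  apply NoDup_cons_iff in HD as [Hh HE].
  (* The cochain on a slice: each face of the slice is thickened by one unit in direction [h]. *)
  set (phi' := fun v F => phi v (h :: F)).
  transitivity (xsum (fun t =>
    xorb (xorb (grid M E (fun v => phi v E) (upd b h t))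
               (grid M E (fun v => phi v E) (upd b h (S t))))
         (grid M E (fun v => delta phi' v E) (upd b h t))) (seq 0 M)).
  - cbn [grid]. apply xsum_ext. intros t _.
    rewrite <- (step_upd_same b h t), <- grid_step by exact Hh.
    rewrite <- !grid_xorb. f_equal. apply functional_extensionality. intro v.
    unfold delta at 1. cbn [picks xsum fold_right fst snd]. f_equal.
    fold (xsum (fun p => xorb (phi v (snd p)) (phi (step v (fst p)) (snd p)))
      (map (fun p => (fst p, h :: snd p)) (picks E))).
    rewrite xsum_map. reflexivity.
  - rewrite xsum_xorb, (xsum_telescope (fun t => grid M E (fun v => phi v E) (upd b h t))).
    cbn [picks xsum fold_right fst snd]. f_equal.
    rewrite (xsum_ext _ _ _ (fun t _ => IH phi' (upd b h t) HE)).
    rewrite xsum_comm.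
    match goal with |- _ = fold_right ?g false ?l =>
      change (fold_right g false l) with (xsum (fun p =>
        xorb (grid M (snd p) (fun v => phi v (snd p)) (upd b (fst p) 0))
             (grid M (snd p) (fun v => phi v (snd p)) (upd b (fst p) M))) l) end.
    rewrite xsum_map. apply xsum_ext. intros [k F] Hk. cbn [fst snd].
    assert (Hkh : h <> k).
    { intros ->. apply Hh. exact (proj1 (picks_NoDup _ _ _ HE Hk)). }
    rewrite xsum_xorb. cbn [grid]. f_equal; apply xsum_ext; intros t _;
      rewrite upd_comm by exact Hkh; reflexivity.
Qed.

(* By Stokes, only the two faces orthogonal to [h] contribute: each other face is
   orthogonal to some [k], so that [s k] is constant on it and the product vanishes. *)
Lemma grid_wedge M (s : nat -> (nat -> nat) -> bool) D : forall b,
  NoDup D ->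
  (forall v i, (forall k, In k D -> v k <= M) -> (forall k, ~ In k D -> v k = b k) ->
     In i D -> (v i = 0 -> s i v = false) /\ (v i = M -> s i v = true)) ->
  grid M D (fun v => wedge (map s D) v D) b = true.
Proof.
  induction D as [|h E IH]; intros b HD Hs; [reflexivity|].
  pose proof HD as HD'. apply NoDup_cons_iff in HD' as [Hh HE].
  assert (Hface : forall c v, c <= M -> in_grid M E (upd b h c) v ->
    (c = 0 -> s h v = false) /\ (c = M -> s h v = true)).
  { intros c v Hc [H1 H2].
    assert (Ev : v h = c) by (rewrite H2 by exact Hh; apply upd_same).
    rewrite <- Ev. apply Hs; [| |simpl; auto].
    - intros k [<-|Hk]; [lia|]. apply H1 in Hk. lia.
    - intros k Hk. simpl in Hk. rewrite H2 by tauto.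
      apply upd_other. intros ->. tauto. }
  cbn [map wedge]. rewrite stokes by exact HD.
  cbn [picks xsum fold_right fst snd].
  match goal with |- context [fold_right ?g false ?l] =>
    replace (fold_right g false l) with false end.
  - rewrite xorb_false_r.
    (* On the bottom face [s h] is 0 and the product vanishes; on the top face it is 1, which leaves
       the sum for [E]. *)
    rewrite (grid_ext _ _ _ (fun _ => false) (upd b h 0) HE), grid_false, xorb_false_l.
    + rewrite (grid_ext _ _ _ (fun v => wedge (map s E) v E) (upd b h M) HE).
      * apply IH; [exact HE|]. intros v i H1 H2 Hi.
        apply Hs; [| |simpl; auto].
        -- intros k [<-|Hk]; auto. rewrite H2, upd_same; auto.
        -- intros k Hk. simpl in Hk. rewrite H2 by tauto.
           apply upd_other. intros ->. tauto.
      * intros v Hv. now rewrite (proj2 (Hface M v (le_n M) Hv) eq_refl).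
    + intros v Hv. now rewrite (proj1 (Hface 0 v (Nat.le_0_l M) Hv) eq_refl).
  - symmetry. apply (xsum_false (fun p => xorb _ _)).
    intros p Hp. apply in_map_iff in Hp as [[k F] [<- Hk]]. cbn [fst snd].
    destruct (picks_NoDup _ _ _ HE Hk) as [HkE [HkF [HF Hincl]]].
    assert (HhF : NoDup (h :: F)).
    { constructor; [intro H; apply Hh; auto|exact HF]. }
    assert (HkhF : ~ In k (h :: F)).
    { intros [->|H]; contradiction. }
    assert (Hz : forall c, c = 0 \/ c = M ->
      grid M (h :: F) (fun v => s h v && wedge (map s E) v (h :: F)) (upd b k c) = false).
    { intros c Hc.
      rewrite (grid_ext _ _ _ (fun _ => false) _ HhF); [apply grid_false|].
      intros v [H1 H2].
      destruct (wedge (map s E) v (h :: F)) eqn:EW; [|apply andb_false_r].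
      exfalso.
      destruct (wedge_local _ _ _ HhF EW (s k) (in_map s E k HkE))
        as [u [u' [Hu [Hu' Hne]]]].
      (* The cube does not extend in direction [k], so all its vertices lie on the same face. *)
      assert (Hcst : forall u, in_cube v (h :: F) u ->
        (c = 0 -> s k u = false) /\ (c = M -> s k u = true)).
      { intros w Hw.
        assert (Ew : w k = c).
        { destruct (Hw k) as [->|[H _]]; [|contradiction].
          rewrite H2 by exact HkhF. apply upd_same. }
        rewrite <- Ew. apply Hs.
        - intros i Hi. destruct (Nat.eq_dec i k) as [->|Hik]; [lia|].
          destruct (Hw i) as [->|[Hi' ->]].
          + destruct (in_dec Nat.eq_dec i (h :: F)) as [Hi'|Hi'].
            * apply H1 in Hi'. lia.
            * exfalso. apply Hi'.
              apply (Permutation_in i (perm_skip h (picks_perm _ _ _ Hk))) in Hi.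
              simpl in *. destruct Hi as [?|[?|?]]; auto. congruence.
          + apply H1 in Hi'. lia.
        - intros i Hi. destruct (Hw i) as [->|[Hi' _]].
          + rewrite H2.
            * apply upd_other. intros ->. apply Hi. simpl. auto.
            * intro Hi'. apply Hi. simpl in *. destruct Hi'; auto.
          + exfalso. apply Hi. simpl in *. destruct Hi'; auto.
        - simpl. auto. }
      destruct Hc as [Hc|Hc].
      - apply Hne. rewrite (proj1 (Hcst u Hu) Hc), (proj1 (Hcst u' Hu') Hc). reflexivity.
      - apply Hne. rewrite (proj2 (Hcst u Hu) Hc), (proj2 (Hcst u' Hu') Hc). reflexivity. }
    rewrite !Hz; auto.
Qed.

(** The products over the grid sum to 1, so some cube has a nonzero product, and by [wedge_local] no
    [s i] is constant on it. *)
Lemma kuhn M n (s : nat -> (nat -> nat) -> bool) :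
  (forall v i, (forall k, k < n -> v k <= M) -> i < n ->
     (v i = 0 -> s i v = false) /\ (v i = M -> s i v = true)) ->
  exists v, (forall k, k < n -> v k < M) /\
    forall i, i < n -> exists u u',
      (forall k, k < n -> v k <= u k <= S (v k)) /\
      (forall k, k < n -> v k <= u' k <= S (v k)) /\ s i u <> s i u'.
Proof.
  intro Hs. set (D := seq 0 n).
  assert (HD : NoDup D) by apply seq_NoDup.
  assert (Hin : forall k, In k D <-> k < n) by (intro k; unfold D; rewrite in_seq; lia).
  assert (HG : grid M D (fun v => wedge (map s D) v D) (fun _ => 0) = true).
  { apply grid_wedge; [exact HD|]. intros v i H1 _ Hi. apply Hs.
    - intros k Hk. apply H1, Hin, Hk.
    - now apply Hin. }
  apply grid_true in HG as [v [[Hv _] HW]]; [|exact HD].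
  exists v. split.
  - intros k Hk. apply Hv, Hin, Hk.
  - intros i Hi.
    destruct (wedge_local _ _ _ HD HW (s i) (in_map s D i (proj2 (Hin i) Hi)))
      as [u [u' [Hu [Hu' Hne]]]].
    exists u, u'. repeat split; auto;
      [destruct (Hu k)|destruct (Hu k)|destruct (Hu' k)|destruct (Hu' k)]; lia.
Qed.

(** * Compactness *)

Local Open Scope R_scope.

Lemma list_choice {A B} (P : A -> B -> Prop) (l : list A) :
  (forall x, In x l -> exists y, P x y) ->
  exists m, (forall x, In x l -> exists y, In y m /\ P x y) /\
            (forall y, In y m -> exists x, In x l /\ P x y).
Proof.
  induction l as [|x l IH]; intro H.
  - exists []. split; simpl; tauto.
  - destruct IH as [m [H1 H2]]; [intros; apply H; simpl; auto|].
    destruct (H x) as [y Hy]; [simpl; auto|].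
    exists (y :: m). split.
    + intros x' [<-|Hx']; [exists y; simpl; auto|].
      destruct (H1 x' Hx') as [y' [? ?]]. exists y'. simpl. auto.
    + intros y' [<-|Hy']; [exists x; simpl; auto|].
      destruct (H2 y' Hy') as [x' [? ?]]. exists x'. simpl. auto.
Qed.

Lemma uniform_in {A} (l : list A) (Phi : A -> R -> Prop) :
  (forall x e e', Phi x e -> 0 < e' -> e' <= e -> Phi x e') ->
  (forall x, In x l -> exists e, 0 < e /\ Phi x e) ->
  exists e, 0 < e /\ forall x, In x l -> Phi x e.
Proof.
  intros Hanti. induction l as [|x l IH]; intro H.
  - exists 1. split; [lra|]. intros x [].
  - destruct IH as [e1 [He1 H1]]; [intros; apply H; simpl; auto|].
    destruct (H x) as [e2 [He2 H2]]; [simpl; auto|].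
    pose proof (Rmin_glb_lt _ _ _ He1 He2).
    pose proof (Rmin_l e1 e2). pose proof (Rmin_r e1 e2).
    exists (Rmin e1 e2). split; [assumption|].
    intros y [<-|Hy]; [apply (Hanti _ e2)|apply (Hanti _ e1)]; auto.
Qed.

Lemma uniform_lt (n : nat) (Phi : nat -> R -> Prop) :
  (forall i e e', Phi i e -> 0 < e' -> e' <= e -> Phi i e') ->
  (forall i, (i < n)%nat -> exists e, 0 < e /\ Phi i e) ->
  exists e, 0 < e /\ forall i, (i < n)%nat -> Phi i e.
Proof.
  intros Hanti H.
  destruct (uniform_in (seq 0 n) Phi Hanti) as [e [He H']].
  - intros i Hi. apply H. apply in_seq in Hi. lia.
  - exists e. split; [exact He|]. intros i Hi. apply H'. apply in_seq. lia.
Qed.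

Section Metric.
Context {X : Type} (d : X -> X -> R) (Hd : is_metric d).

Lemma d_refl x : d x x = 0.
Proof. now apply Hd. Qed.

Lemma d_sym x y : d x y = d y x.
Proof. apply Hd. Qed.

Lemma d_tri x y z : d x z <= d x y + d y z.
Proof. apply Hd. Qed.

Lemma ball_open x r : open_set d (fun y => d x y < r).
Proof.
  intros y Hy. exists (r - d x y). split; [lra|].
  intros z Hz. pose proof (d_tri x y z). lra.
Qed.

(** Returning indices rather than open sets keeps the data attached to the members of the
    subcover. *)
Lemma compact_indexed {I : Type} (K : X -> Prop) (P : I -> Prop) (U : I -> X -> Prop) :
  compact_set d K -> (forall i, P i -> open_set d (U i)) ->
  (forall x, K x -> exists i, P i /\ U i x) ->
  exists m, (forall i, In i m -> P i) /\ forall x, K x -> exists i, In i m /\ U i x.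
Proof.
  intros HK HU Hcov.
  destruct (HK (fun V => exists i, P i /\ V = U i)) as [l [Hl Hl']].
  - intros V [i [Hi ->]]. auto.
  - intros x Hx. destruct (Hcov x Hx) as [i [Hi Hxi]]. eauto.
  - rewrite Forall_forall in Hl.
    destruct (list_choice _ _ Hl) as [m [H1 H2]].
    exists m. split.
    + intros i Hi. destruct (H2 i Hi) as [V [_ [H _]]]. exact H.
    + intros x Hx. destruct (Hl' x Hx) as [V [HV Hxv]].
      destruct (H1 V HV) as [i [Hi [_ ->]]]. eauto.
Qed.

Lemma compact_balls (K : X -> Prop) (Q : X -> R -> Prop) :
  compact_set d K -> (forall x, K x -> exists r, 0 < r /\ Q x r) ->
  exists l : list (X * R),
    (forall p, In p l -> K (fst p) /\ 0 < snd p /\ Q (fst p) (snd p)) /\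
    forall x, K x -> exists p, In p l /\ d (fst p) x < snd p.
Proof.
  intros HK HQ.
  apply (compact_indexed K (fun p => K (fst p) /\ 0 < snd p /\ Q (fst p) (snd p))
           (fun p y => d (fst p) y < snd p) HK).
  - intros p _. apply ball_open.
  - intros x Hx. destruct (HQ x Hx) as [r [Hr H]]. exists (x, r). cbn [fst snd].
    rewrite d_refl. auto.
Qed.

(** Finitely many balls of local validity suffice, and the least of their radii works everywhere.
    This is the common source of the uniform continuity and positive distance statements below. *)
Lemma compact_uniform (K : X -> Prop) (Phi : X -> R -> Prop) :
  compact_set d K ->
  (forall x e e', Phi x e -> 0 < e' -> e' <= e -> Phi x e') ->
  (forall x, K x -> exists e, 0 < e /\ forall y, K y -> d x y < e -> Phi y e) ->
  exists e, 0 < e /\ forall x, K x -> Phi x e.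
Proof.
  intros HK Hanti Hloc.
  destruct (compact_balls K _ HK Hloc) as [l [Hl Hcov]].
  destruct (uniform_in l (fun p e => e <= snd p)) as [e [He Hmin]].
  - intros; lra.
  - intros p Hp. exists (snd p). split; [apply Hl, Hp|lra].
  - exists e. split; [exact He|]. intros x Hx.
    destruct (Hcov x Hx) as [p [Hp Hxp]].
    apply (Hanti _ (snd p)); auto. apply Hl; auto.
Qed.

Definition closed_in (K C : X -> Prop) : Prop :=
  forall x, K x -> ~ C x -> exists r, 0 < r /\ forall y, K y -> d x y < r -> ~ C y.

Lemma compact_closed (K C : X -> Prop) :
  compact_set d K -> (forall x, C x -> K x) -> closed_in K C -> compact_set d C.
Proof.
  intros HK HCK HC F HF Hcov.
  (* The cover of [C] is completed to one of [K] by open sets whose trace on [K] misses [C]. *)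
  destruct (compact_indexed K
    (fun V => F V \/ open_set d V /\ forall y, K y -> V y -> ~ C y) (fun V => V) HK)
    as [m [Hm Hm']].
  - intros V [H|[H _]]; auto.
  - intros x Hx. destruct (classic (C x)) as [Cx|Cx].
    + destruct (Hcov x Cx) as [V [? ?]]. eauto.
    + destruct (HC x Hx Cx) as [r [Hr H]]. exists (fun y => d x y < r). split.
      * right. split; [apply ball_open|exact H].
      * now rewrite d_refl.
  - assert (Hf : exists l, Forall F l /\ forall V, In V m -> F V -> In V l).
    { clear. induction m as [|V m [l [H1 H2]]].
      - exists []. split; [constructor|simpl; tauto].
      - destruct (classic (F V)) as [HV|HV].
        + exists (V :: l). split; [constructor; auto|].
          intros W [<-|HW] HFW; simpl; auto.
        + exists l. split; [exact H1|]. intros W [<-|HW] HFW; [contradiction|auto]. }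
    destruct Hf as [l [H1 H2]]. exists l. split; [exact H1|].
    intros x Cx. destruct (Hm' x (HCK x Cx)) as [V [HV HxV]].
    exists V. split; [|exact HxV]. apply H2; [exact HV|].
    destruct (Hm V HV) as [H|[_ H]]; [exact H|]. exfalso. now apply (H x (HCK x Cx)).
Qed.

(** Continuity is asked only along [B], because chart coordinates are controlled only inside the
    chart. *)
Lemma closed_in_sublevel {J : Type} (K B : X -> Prop) (P : J -> Prop) (h : J -> X -> R)
    (c : J -> R) :
  closed_in K B ->
  (forall x i e, B x -> P i -> 0 < e ->
     exists del, 0 < del /\ forall y, B y -> d x y < del -> Rabs (h i x - h i y) < e) ->
  closed_in K (fun x => B x /\ forall i, P i -> h i x <= c i).
Proof.
  intros HB Hh x Hx Hn. destruct (classic (B x)) as [Bx|Bx].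
  - assert (Hi : exists i, P i /\ c i < h i x).
    { apply NNPP. intro H. apply Hn. split; [exact Bx|]. intros i Hi.
      apply Rnot_lt_le. intro Hlt. eauto. }
    destruct Hi as [i [Hi Hlt]].
    destruct (Hh x i (h i x - c i) Bx Hi ltac:(lra)) as [del [Hdel H]].
    exists del. split; [exact Hdel|]. intros y _ Hxy [By Hy].
    specialize (H y By Hxy). specialize (Hy i Hi). apply Rabs_def2 in H. lra.
  - destruct (HB x Hx Bx) as [r [Hr H]]. exists r. split; [exact Hr|].
    intros y Ky Hxy [By _]. exact (H y Ky Hxy By).
Qed.

End Metric.

(** * Certificates *)

(** A label codes a coordinate and a side, 1 for lower and 2 for upper; the relation is directed
    from lower to upper. *)
Definition opposite (a b : nat) : Prop :=
  (pi1 a = pi1 b /\ pi2 a = 1 /\ pi2 b = 2)%nat.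

Definition is_side (n l : nat) : Prop := (pi1 l < n /\ (pi2 l = 1 \/ pi2 l = 2))%nat.

Definition sides (n : nat) : list nat :=
  flat_map (fun i => [cpair i 1; cpair i 2]) (seq 0 n).

Lemma in_sides n l : In l (sides n) <-> is_side n l.
Proof.
  unfold sides, is_side. rewrite in_flat_map. split.
  - intros [i [Hi Hl]]. apply in_seq in Hi.
    destruct Hl as [<-|[<-|[]]]; rewrite pi1_cpair, pi2_cpair; lia.
  - intros [H1 H2]. exists (pi1 l). split; [apply in_seq; lia|].
    pose proof (cpair_pi l) as E. destruct H2 as [H2|H2]; rewrite H2 in E; simpl; auto.
Qed.

Section Certificates.
Context {X : Type} (d : X -> X -> R) (alpha : nat -> X) (q : nat -> R)
  (tau1 tau2 : nat -> nat) (sigma : nat -> nat -> nat) (eta : nat -> nat).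
Context (HX : computable_metric_space d alpha)
  (Hv : valid_enums q tau1 tau2 sigma eta).

Let lam := lam alpha tau1.
Let rho := rho q tau2.
Let Iball := Iball d alpha q tau1 tau2.
Let Junion := Junion d alpha q tau1 tau2 sigma eta.

Lemma HXd : is_metric d.
Proof. apply HX. Qed.

Lemma small_ball x eps : 0 < eps ->
  exists b, Iball b x /\ rho b < eps /\ d x (lam b) < eps.
Proof.
  intro He. destruct (archimed_cor1 eps He) as [m [Hm Hm0]].
  assert (Hm' : 0 < / INR m) by (apply Rinv_0_lt_compat, lt_0_INR; exact Hm0).
  destruct HX as [_ [Hdense _]]. destruct (Hdense x _ Hm') as [i Hi].
  destruct Hv as [_ [Hq [_ [_ [Htau _]]]]].
  destruct (proj2 (Hq (/ INR m))) as [k Hk].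
  { split; [exact Hm'|]. exists 1%Z, m. split; [exact Hm0|]. unfold Rdiv. lra. }
  destruct (Htau i k) as [b [H1 H2]]. exists b.
  unfold Iball, Defs.Iball, rho, Defs.rho, lam, Defs.lam. rewrite H1, H2, Hk.
  repeat split; lra.
Qed.

Lemma Iball_open b : open_set d (Iball b).
Proof.
  intros y Hy. unfold Iball, Defs.Iball in *.
  exists (Defs.rho q tau2 b - d y (Defs.lam alpha tau1 b)). split; [lra|].
  intros z Hz. pose proof (d_tri d HXd z y (Defs.lam alpha tau1 b)).
  rewrite (d_sym d HXd z y) in H. lra.
Qed.

Lemma ball_cover K eps : compact_set d K -> 0 < eps ->
  exists L, (forall b, In b L -> rho b < eps /\ exists x, K x /\ d x (lam b) < eps) /\
    forall x, K x -> exists b, In b L /\ Iball b x.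
Proof.
  intros HK He. apply (compact_indexed d K _ Iball HK).
  - intros b _. apply Iball_open.
  - intros x Hx. destruct (small_ball x eps He) as [b [H1 [H2 H3]]].
    exists b. eauto.
Qed.

(** Each piece is covered separately. Small radii and centres close to the piece let distances
    between pieces pass to the balls. *)
Lemma labelled_cover (labels : list nat) (C : nat -> X -> Prop) eps :
  (forall l, In l labels -> compact_set d (C l)) -> 0 < eps ->
  exists L : list (nat * nat),
    (forall b l, In (b, l) L ->
       In l labels /\ rho b < eps /\ exists x, C l x /\ d x (lam b) < eps) /\
    (forall l x, In l labels -> C l x -> exists b, In (b, l) L /\ Iball b x).
Proof.
  intros HC He. induction labels as [|l0 labels IH].
  - exists []. split; simpl; tauto.
  - destruct IH as [L [H1 H2]]; [intros; apply HC; simpl; auto|].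
    destruct (ball_cover (C l0) eps) as [L0 [H3 H4]]; [apply HC; simpl; auto|exact He|].
    exists (map (fun b => (b, l0)) L0 ++ L). split.
    + intros b l Hbl. apply in_app_or in Hbl as [Hbl|Hbl].
      * apply in_map_iff in Hbl as [b' [[= <- <-] Hb]].
        split; [simpl; auto|]. now apply H3.
      * destruct (H1 b l Hbl) as [? ?]. simpl. auto.
    + intros l x [<-|Hl] Hx.
      * destruct (H4 x Hx) as [b [Hb Hxb]]. exists b. split; [|exact Hxb].
        apply in_or_app. left. apply in_map_iff. eauto.
      * destruct (H2 l x Hl Hx) as [b [Hb Hxb]]. exists b. split; [|exact Hxb].
        apply in_or_app. auto.
Qed.

(** Formal disjointness: a strict inequality between computable reals, hence semi-decidable, which
    forces the balls to be at positive distance. *)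
Definition apart (i j : nat) : Prop := rho i + rho j < d (lam i) (lam j).

(** The factor 4 pays for two radii and two displacements of the centres. *)
Lemma apart_near i j x y e :
  rho i < e -> rho j < e -> d x (lam i) < e -> d y (lam j) < e -> 4 * e <= d x y ->
  apart i j.
Proof.
  intros. unfold apart.
  pose proof (d_tri d HXd x (lam i) y). pose proof (d_tri d HXd (lam i) (lam j) y).
  rewrite (d_sym d HXd (lam j) y) in *. lra.
Qed.

Lemma apart_gap i j : apart i j ->
  exists e, 0 < e /\ forall x y, Iball i x -> Iball j y -> e <= d x y.
Proof.
  unfold apart, Iball, Defs.Iball. intro H.
  exists (d (lam i) (lam j) - rho i - rho j). split; [lra|].
  intros x y Hx Hy. fold (lam i) (rho i) in Hx. fold (lam j) (rho j) in Hy.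
  pose proof (d_tri d HXd (lam i) x (lam j)). pose proof (d_tri d HXd x y (lam j)).
  rewrite (d_sym d HXd (lam i) x) in *. lra.
Qed.

(* The data [P] depends on a chart of [S]: ball indices with labels [(i, 1)] and
   [(i, 2)] for the two sides of the [i]-th coordinate, or [(_, 0)] for balls that avoid
   the cube under consideration.  The pairs [(sigma j m, sigma e m)] extend [P] to a cover
   of [S] in which balls with opposite labels are formally disjoint and only the ball
   [I] is unconstrained. *)
Definition certificate (S : X -> Prop) (n : nat) (P : list (nat * nat)) (I : nat) : Prop :=
  exists j e,
    (forall x, S x -> Junion j x) /\
    (length P <= eta j)%nat /\
    (forall k, (k < length P)%nat -> sigma j k = fst (nth k P (0, 0)%nat) /\
                                sigma e k = snd (nth k P (0, 0)%nat)) /\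
    sigma j (length P) = I /\
    (forall m, (m <= eta j)%nat -> (length P < m)%nat -> is_side n (sigma e m)) /\
    (forall m, (m <= eta j)%nat -> forall m', (m' <= eta j)%nat ->
       opposite (sigma e m) (sigma e m') -> apart (sigma j m) (sigma j m')).

Lemma apart_re : re (fun p => apart (pi1 p) (pi2 p)).
Proof.
  destruct HX as [_ [_ [cA [cB [cC Happ]]]]].
  destruct Hv as [[A [B [C [HA [HB [HC Hq]]]]]] [_ [H1 [H2 _]]]].
  (* Choice turns the values of the three codes into functions, which those same codes compute. *)
  destruct (choice (fun (p : nat) (t : nat * nat * nat) =>
    prf_eval cA p (fst (fst t)) /\ prf_eval cB p (snd (fst t)) /\ prf_eval cC p (snd t) /\
    Rabs (d (alpha (pi1 (pi1 p))) (alpha (pi2 (pi1 p)))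
          - ratcode (fst (fst t)) (snd (fst t)) (snd t)) < / 2 ^ pi2 p)) as [T HT].
  { intro p. destruct (Happ (pi1 (pi1 p)) (pi2 (pi1 p)) (pi2 p)) as [a [b [c H]]].
    exists (a, b, c). rewrite !cpair_pi in H. exact H. }
  set (TA := fun p => fst (fst (T p))). set (TB := fun p => snd (fst (T p))).
  set (TC := fun p => snd (T p)).
  assert (HTA : computable1 TA) by (exists cA; intro p; apply HT).
  assert (HTB : computable1 TB) by (exists cB; intro p; apply HT).
  assert (HTC : computable1 TC) by (exists cC; intro p; apply HT).
  (* [lhs p k < rhs p k] compares [rho i + rho j + 2^-k] with the rational approximation
     of [d (lam i) (lam j)] up to [2^-k], with all denominators cleared. *)
  set (arg := fun p k => cpair (cpair (tau1 (pi1 p)) (tau1 (pi2 p))) k).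
  set (lhs := fun p k =>
    let D1 := S (C (tau2 (pi1 p))) in let D2 := S (C (tau2 (pi2 p))) in
    let D := S (TC (arg p k)) in
    (A (tau2 (pi1 p)) * D2 * D * 2 ^ k + A (tau2 (pi2 p)) * D1 * D * 2 ^ k
     + D1 * D2 * D + TB (arg p k) * D1 * D2 * 2 ^ k)%nat).
  set (rhs := fun p k =>
    let D1 := S (C (tau2 (pi1 p))) in let D2 := S (C (tau2 (pi2 p))) in
    let D := S (TC (arg p k)) in
    (B (tau2 (pi1 p)) * D2 * D * 2 ^ k + B (tau2 (pi2 p)) * D1 * D * 2 ^ k
     + TA (arg p k) * D1 * D2 * 2 ^ k)%nat).
  apply (re_ext (fun p => exists k, (lhs p k < rhs p k)%nat)).
  - intro p.
    assert (Hk : forall k, (lhs p k < rhs p k)%nat <->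
      rho (pi1 p) + rho (pi2 p) + / 2 ^ k <
      ratcode (TA (arg p k)) (TB (arg p k)) (TC (arg p k))).
    { intro k. unfold rho, Defs.rho. rewrite !Hq. unfold ratcode.
      transitivity (INR (lhs p k) < INR (rhs p k)).
      { split; [apply lt_INR|apply INR_lt]. }
      unfold lhs, rhs. cbv zeta.
      rewrite !plus_INR, !mult_INR, !pow_INR.
      replace (INR 2) with 2 by reflexivity. rewrite !S_INR.
      set (a1 := INR (A _)). set (a2 := INR (A _)). set (b1 := INR (B _)).
      set (b2 := INR (B _)). set (a := INR (TA _)). set (b := INR (TB _)).
      set (D1 := INR (C (tau2 (pi1 p))) + 1). set (D2 := INR (C (tau2 (pi2 p))) + 1).
      set (D := INR (TC _) + 1).
      assert (0 < D1) by (unfold D1; pose proof (pos_INR (C (tau2 (pi1 p)))); lra).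
      assert (0 < D2) by (unfold D2; pose proof (pos_INR (C (tau2 (pi2 p)))); lra).
      assert (0 < D) by (unfold D; pose proof (pos_INR (TC (arg p k))); lra).
      assert (0 < 2 ^ k) by (apply pow_lt; lra).
      set (Q := 2 ^ k) in *.
      assert (HP : 0 < D1 * D2 * D * Q) by (repeat apply Rmult_lt_0_compat; assumption).
      set (l := (a1 - b1) / D1 + (a2 - b2) / D2 + / Q). set (r := (a - b) / D).
      assert (E : (r - l) * (D1 * D2 * D * Q) =
        (b1 * D2 * D * Q + b2 * D1 * D * Q + a * D1 * D2 * Q) -
        (a1 * D2 * D * Q + a2 * D1 * D * Q + D1 * D2 * D + b * D1 * D2 * Q)).
      { unfold r, l. field. repeat split; lra. }
      split; intro Hlt.
      - apply Rnot_le_lt. intro Hle.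
        assert ((r - l) * (D1 * D2 * D * Q) <= 0).
        { rewrite <- (Rmult_0_l (D1 * D2 * D * Q)). apply Rmult_le_compat_r; lra. }
        lra.
      - assert (0 < (r - l) * (D1 * D2 * D * Q)) by (apply Rmult_lt_0_compat; lra).
        lra. }
    assert (Hap : forall k, Rabs (d (lam (pi1 p)) (lam (pi2 p)) -
      ratcode (TA (arg p k)) (TB (arg p k)) (TC (arg p k))) < / 2 ^ k).
    { intro k. destruct (HT (arg p k)) as [_ [_ [_ H]]].
      assert (E1 : pi1 (pi1 (arg p k)) = tau1 (pi1 p))
        by (unfold arg; now rewrite !pi1_cpair).
      assert (E2 : pi2 (pi1 (arg p k)) = tau1 (pi2 p))
        by (unfold arg; now rewrite pi1_cpair, pi2_cpair).
      assert (E3 : pi2 (arg p k) = k) by apply pi2_cpair.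
      rewrite E1, E2, E3 in H. exact H. }
    unfold apart. split.
    + intros [k H]. apply Hk in H. specialize (Hap k). apply Rabs_def2 in Hap. lra.
    + intro H. set (gam := d (lam (pi1 p)) (lam (pi2 p)) - (rho (pi1 p) + rho (pi2 p))).
      (* Half of the gap absorbs the approximation error, the other half the summand [2^-k]. *)
      destruct (pow_lt_1_zero (/ 2)) with (y := gam / 2) as [k HN].
      { rewrite Rabs_right; lra. }
      { unfold gam. lra. }
      specialize (HN k (le_n k)). rewrite Rabs_right in HN.
      2:{ apply Rle_ge, pow_le. lra. }
      rewrite pow_inv in HN. exists k. apply Hk. specialize (Hap k).
      apply Rabs_def2 in Hap. unfold gam in HN. lra.
  - apply re_ex, decidable_re, decidable_lt; unfold lhs, rhs, arg; cbv zeta; computability.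
Qed.


Lemma certificate_re S n P : ce (fun j => forall x, S x -> Junion j x) ->
  re (certificate S n P).
Proof.
  intro HJ. apply ce_re in HJ. pose proof apart_re as Hap.
  destruct Hv as [_ [_ [_ [_ [_ [Hs [Heta _]]]]]]].
  apply computable2_uncurry in Hs.
  unfold certificate. apply re_ex, re_ex.
  apply re_and; [|apply re_and; [|apply re_and; [|apply re_and; [|apply re_and]]]].
  - apply (re_comp _ (fun p => pi2 (pi1 p)) HJ). computability.
  - apply (re_ext (fun p => length P < Datatypes.S (eta (pi2 (pi1 p))))%nat).
    + intro p. lia.
    + apply decidable_re, decidable_lt; computability.
  (* [P] is a fixed list, so this is a finite conjunction of decidable conditions. *)
  - apply re_all_lt. intros k _.
    apply re_and; apply decidable_re, decidable_eq; computability.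
  - apply decidable_re, decidable_eq; computability.
  - apply re_bounded_all; [computability|].
    apply re_impl; [apply decidable_lt; computability|].
    unfold is_side. apply re_and; [apply decidable_re, decidable_lt; computability|].
    apply re_or; apply decidable_re, decidable_eq; computability.
  - apply re_bounded_all; [computability|].
    apply re_bounded_all; [computability|].
    apply re_impl.
    + unfold opposite.
      repeat apply decidable_and; apply decidable_eq; computability.
    + apply (re_comp2 apart); [exact Hap| |]; computability.
Qed.

(** Balls and labels get separate codes [j] and [e] of equal length, since [sigma] enumerates
    sequences of numbers. *)
Lemma realize_list (l : list (nat * nat)) : l <> [] ->
  exists j e, length l = S (eta j) /\
    forall k, (k < length l)%nat -> sigma j k = fst (nth k l (0, 0)%nat) /\
                               sigma e k = snd (nth k l (0, 0)%nat).
Proof.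
  intro Hl. destruct Hv as [_ [_ [_ [_ [_ [_ [_ Hs]]]]]]].
  assert (Hm : forall h : nat * nat -> nat, map h l <> []) by (destruct l; easy).
  destruct (Hs (map fst l) (Hm fst)) as [j [Hj Hj']].
  destruct (Hs (map snd l) (Hm snd)) as [e [_ He']].
  rewrite length_map in *. exists j, e. split; [exact Hj|].
  intros k Hk. rewrite <- Hj', <- He' by exact Hk. split.
  - apply (map_nth fst l (0, 0)%nat).
  - apply (map_nth snd l (0, 0)%nat).
Qed.

(** * Cubes in a chart around a point *)

Section Chart.
Context (M : X -> Prop) (HM : compact_set d M) (n : nat) (N : X -> Prop)
  (f : X -> nat -> R) (g : (nat -> R) -> X).
Context (HNM : forall x, N x -> M x)
  (Hf : forall x, N x -> Rn n (f x))
  (Hg : forall v, Rn n v -> N (g v))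
  (Hgf : forall x, N x -> g (f x) = x)
  (Hfg : forall v, Rn n v -> f (g v) = v)
  (Hfc : forall x eps, N x -> 0 < eps -> exists del, 0 < del /\
     forall y, N y -> d x y < del ->
       forall i, (i < n)%nat -> Rabs (f x i - f y i) < eps)
  (Hgc : forall v eps, Rn n v -> 0 < eps -> exists del, 0 < del /\
     forall w, Rn n w -> (forall i, (i < n)%nat -> Rabs (v i - w i) < del) ->
       d (g v) (g w) < eps).
Context (x0 : X) (Hx0 : M x0) (r a : R) (Hr : 0 < r) (Ha : 0 < a)
  (HrN : forall y, M y -> d x0 y <= r -> N y)
  (Har : forall w, Rn n w -> (forall i, (i < n)%nat -> Rabs (w i - f x0 i) <= 2 * a) ->
     d x0 (g w) < r).

Let Hd : is_metric d := HXd.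
Let tri := d_tri d Hd.
Let sym := d_sym d Hd.

(** A closed piece of [M] inside the chart domain [N], on which compactness can be used. *)
Definition base (x : X) : Prop := M x /\ d x0 x <= r.
Definition u (i : nat) (x : X) : R := f x i - f x0 i.
Definition box (c : R) (x : X) : Prop :=
  base x /\ forall i, (i < n)%nat -> Rabs (u i x) <= c.
(** The complement in [M] of an open cube; together with [box (2 * a)] it covers [M]. *)
Definition outside (x : X) : Prop :=
  M x /\ ~ (d x0 x < r /\ forall i, (i < n)%nat -> Rabs (u i x) < 2 * a).

Lemma base_N x : base x -> N x.
Proof. intros [H1 H2]. auto. Qed.

Lemma u_continuous x e : base x -> 0 < e ->
  exists del, 0 < del /\ forall y, base y -> d x y < del ->
    forall i, (i < n)%nat -> Rabs (u i x - u i y) < e.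
Proof.
  intros Hx He. destruct (Hfc x e (base_N x Hx) He) as [del [Hdel H]].
  exists del. split; [exact Hdel|]. intros y Hy Hxy i Hi. unfold u.
  replace (f x i - f x0 i - (f y i - f x0 i)) with (f x i - f y i) by ring.
  apply H; auto. now apply base_N.
Qed.

Lemma closed_base : closed_in d M base.
Proof.
  intros x Hx Hn. assert (r < d x0 x).
  { apply Rnot_le_lt. intro. apply Hn. now split. }
  exists (d x0 x - r). split; [lra|]. intros y _ Hxy [_ Hy].
  pose proof (tri x0 y x). rewrite (sym y x) in *. lra.
Qed.

Lemma closed_box c : closed_in d M (box c).
Proof.
  apply (closed_in_sublevel d M base (fun i => (i < n)%nat)
    (fun i x => Rabs (u i x)) (fun _ => c) closed_base).
  intros x i e Hx Hi He. destruct (u_continuous x e Hx He) as [del [Hdel H]].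
  exists del. split; [exact Hdel|]. intros y Hy Hxy.
  eapply Rle_lt_trans; [apply Rabs_triang_inv2|]. now apply H.
Qed.

Lemma compact_box c : compact_set d (box c).
Proof.
  apply (compact_closed d Hd M); [exact HM| |apply closed_box].
  intros x [[H _] _]. exact H.
Qed.

(** The sign [s] treats lower and upper halves at once. *)
Lemma compact_half c s i t : (i < n)%nat -> Rabs s = 1 ->
  compact_set d (fun x => box c x /\ s * u i x <= t).
Proof.
  intros Hi Hs.
  apply (compact_closed d Hd M); [exact HM|intros x [[[H _] _] _]; exact H|].
  pose proof (closed_in_sublevel d M (box c) (fun _ : unit => True)
    (fun _ x => s * u i x) (fun _ => t) (closed_box c)) as H.
  intros x Hx Hn. destruct (H) with (x := x) as [rr [Hrr H']].
  - intros y _ e [Hy _] _ He. destruct (u_continuous y e Hy He) as [del [Hdel Hc]].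
    exists del. split; [exact Hdel|]. intros z [Hz _] Hyz.
    rewrite <- Rmult_minus_distr_l, Rabs_mult, Hs, Rmult_1_l. now apply Hc.
  - exact Hx.
  - intros [H1 H2]. apply Hn. split; [exact H1|]. exact (H2 tt I).
  - exists rr. split; [exact Hrr|]. intros y Hy Hxy [H1 H2].
    apply (H' y Hy Hxy). split; auto.
Qed.

Lemma box_weaken c c' x : c <= c' -> box c x -> box c' x.
Proof.
  intros Hc [H1 H2]. split; [exact H1|]. intros i Hi. specialize (H2 i Hi). lra.
Qed.

Lemma box_interior c x : c <= 2 * a -> box c x -> d x0 x < r.
Proof.
  intros Hc [H1 H2]. apply base_N in H1. rewrite <- (Hgf x H1).
  apply Har; [now apply Hf|]. intros i Hi. specialize (H2 i Hi). unfold u in H2. lra.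
Qed.

(** Contrapositive of the uniform continuity of the coordinates on a compact cube, with the factor 4
    required by [apart_near]. *)
Lemma u_gap c e : 0 < e -> exists del, 0 < del /\
  forall i x y, (i < n)%nat -> box c x -> box c y -> u i x + e <= u i y ->
    4 * del <= d x y.
Proof.
  intro He.
  destruct (compact_uniform d Hd (box c) (fun x del => forall y, box c y ->
    d x y < del -> forall i, (i < n)%nat -> Rabs (u i x - u i y) < e) (compact_box c))
    as [del [Hdel H]].
  - intros x e1 e2 H1 _ H2 y Hy Hxy. apply H1; [exact Hy|lra].
  - intros x [Hx _]. destruct (u_continuous x (e / 2) Hx ltac:(lra)) as [del [Hdel H]].
    exists (del / 2). split; [lra|]. intros y Hy Hxy z Hz Hyz i Hi.
    pose proof (tri x y z).
    pose proof (H y (proj1 Hy) ltac:(lra) i Hi) as H1.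
    pose proof (H z (proj1 Hz) ltac:(lra) i Hi) as H2.
    apply Rabs_def2 in H1, H2. apply Rabs_def1; lra.
  - exists (del / 4). split; [lra|]. intros i x y Hi Hx Hy Hu.
    apply Rnot_lt_le. intro Hlt.
    specialize (H x Hx y Hy ltac:(lra) i Hi). apply Rabs_def2 in H. lra.
Qed.

(** Uniform continuity of the inverse chart; it will make neighbouring grid points close in [X]. *)
Lemma u_inverse_uniform e : 0 < e -> exists kap, 0 < kap /\
  forall x y, box a x -> box a y ->
    (forall i, (i < n)%nat -> Rabs (u i x - u i y) < kap) -> d x y < e.
Proof.
  intro He.
  destruct (compact_uniform d Hd (box a) (fun x kap => forall y, box a y ->
    (forall i, (i < n)%nat -> Rabs (u i x - u i y) < kap) -> d x y < e) (compact_box a))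
    as [kap [Hkap H]].
  - intros x e1 e2 H1 _ H2 y Hy Hxy. apply H1; [exact Hy|].
    intros i Hi. specialize (Hxy i Hi). lra.
  - intros x [Hx _]. pose proof (base_N x Hx) as Nx.
    destruct (Hgc (f x) (e / 2) (Hf x Nx) ltac:(lra)) as [kap [Hkap H]].
    rewrite (Hgf x Nx) in H.
    assert (Hnear : forall y, base y ->
      (forall i, (i < n)%nat -> Rabs (u i x - u i y) < kap) -> d x y < e / 2).
    { intros y Hy Hxy. apply base_N in Hy. rewrite <- (Hgf y Hy).
      apply H; [now apply Hf|]. intros i Hi. specialize (Hxy i Hi). unfold u in Hxy.
      replace (f x i - f y i) with (f x i - f x0 i - (f y i - f x0 i)) by ring.
      exact Hxy. }
    destruct (u_continuous x (kap / 2) Hx ltac:(lra)) as [del [Hdel Hc]].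
    (* [y] and then [z] each move the coordinates by less than [kap / 2], so both stay in the region
       where the inverse chart varies by less than [e / 2]. *)
    exists (Rmin del (kap / 2)). split; [apply Rmin_glb_lt; lra|].
    pose proof (Rmin_l del (kap / 2)). pose proof (Rmin_r del (kap / 2)).
    intros y Hy Hxy z Hz Hyz.
    assert (Hxy' : forall i, (i < n)%nat -> Rabs (u i x - u i y) < kap / 2).
    { apply Hc; [apply Hy|lra]. }
    pose proof (tri y x z). rewrite (sym y x) in *.
    assert (d x y < e / 2).
    { apply Hnear; [apply Hy|]. intros i Hi. specialize (Hxy' i Hi). lra. }
    assert (d x z < e / 2).
    { apply Hnear; [apply Hz|]. intros i Hi. specialize (Hxy' i Hi).
      specialize (Hyz i Hi). apply Rabs_def2 in Hxy', Hyz. apply Rabs_def1; lra. }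
    lra.
  - exists kap. split; [exact Hkap|]. intros x y Hx Hy Hxy. exact (H x Hx y Hy Hxy).
Qed.

Lemma closed_outside : closed_in d M outside.
Proof.
  intros x Hx Hn.
  assert (Hin : d x0 x < r /\ forall i, (i < n)%nat -> Rabs (u i x) < 2 * a).
  { apply NNPP. intro H. apply Hn. now split. }
  destruct Hin as [Hxr Hu].
  destruct (uniform_lt n (fun i e => Rabs (u i x) + e <= 2 * a)) as [e [He Hue]].
  - intros; lra.
  - intros i Hi. specialize (Hu i Hi). exists (2 * a - Rabs (u i x)). lra.
  - assert (Bx : base x) by (split; [exact Hx|lra]).
    destruct (u_continuous x e Bx He) as [del [Hdel H]].
    exists (Rmin del (r - d x0 x)). split; [apply Rmin_glb_lt; lra|].
    pose proof (Rmin_l del (r - d x0 x)). pose proof (Rmin_r del (r - d x0 x)).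
    intros y Hy Hxy [_ Hout]. apply Hout. pose proof (tri x0 x y).
    split; [lra|]. intros i Hi.
    specialize (H y ltac:(split; [exact Hy|lra]) ltac:(lra) i Hi).
    specialize (Hue i Hi). pose proof (Rabs_triang_inv (u i y) (u i x)).
    rewrite (Rabs_minus_sym (u i y)) in *. lra.
Qed.

Lemma compact_outside : compact_set d outside.
Proof.
  apply (compact_closed d Hd M); [exact HM| |apply closed_outside].
  intros x [H _]. exact H.
Qed.

(** The cube is compact and disjoint from the relatively closed set [outside]. *)
Lemma outside_gap : exists del, 0 < del /\
  forall x y, outside x -> box a y -> del <= d x y.
Proof.
  destruct (compact_uniform d Hd (box a) (fun y del => forall x, outside x ->
    del <= d x y) (compact_box a)) as [del [Hdel H]].
  - intros y e1 e2 H1 _ H2 x Hx. specialize (H1 x Hx). lra.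
  - intros y Hy. destruct (closed_outside y (proj1 (proj1 Hy))) as [e [He H]].
    + intros [_ Hn]. apply Hn. split; [apply (box_interior a); [lra|exact Hy]|].
      intros i Hi. pose proof (proj2 Hy i Hi). lra.
    + exists (e / 2). split; [lra|]. intros z _ Hyz x Hx.
      apply Rnot_lt_le. intro Hlt. pose proof (tri y z x). rewrite (sym z x) in *.
      apply (H x (proj1 Hx)); [lra|exact Hx].
  - exists del. split; [exact Hdel|]. auto.
Qed.

(** The inverse chart in coordinates centred at [x0]; entries from [n] on are 0, as [Rn n]
    demands. *)
Definition point (w : nat -> R) : X :=
  g (fun i => if (i <? n)%nat then f x0 i + w i else 0).

Lemma point_box w : (forall i, (i < n)%nat -> Rabs (w i) <= a) ->
  box a (point w) /\ forall i, (i < n)%nat -> u i (point w) = w i.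
Proof.
  intro Hw. unfold point. set (v := fun i => _).
  assert (Hv' : forall i, (i < n)%nat -> v i = f x0 i + w i).
  { intros i Hi. unfold v. apply Nat.ltb_lt in Hi. now rewrite Hi. }
  assert (Rv : Rn n v).
  { intros i Hi. unfold v. apply Nat.ltb_ge in Hi. now rewrite Hi. }
  assert (Hu : forall i, (i < n)%nat -> u i (g v) = w i).
  { intros i Hi. unfold u. rewrite Hfg, Hv' by auto. ring. }
  split; [|exact Hu]. split.
  - split; [auto|]. apply Rlt_le, Har; [exact Rv|]. intros i Hi.
    rewrite Hv' by exact Hi. replace (f x0 i + w i - f x0 i) with (w i) by ring.
    specialize (Hw i Hi). lra.
  - intros i Hi. rewrite Hu by exact Hi. auto.
Qed.

(** * Soundness of certificates *)

(** If [M] missed the ball [I], every point of the cube would lie in a ball with a side label. On a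
    fine grid these labels would violate Kuhn's lemma, the balls of [P] on the faces giving its
    boundary conditions. *)
Lemma certificate_sound P I :
  (forall b l, In (b, l) P ->
     (forall x, box a x -> ~ Iball b x) \/ is_side n l) ->
  (forall i x, (i < n)%nat -> box a x -> u i x = - a ->
     exists b, In (b, cpair i 1) P /\ Iball b x) ->
  (forall i x, (i < n)%nat -> box a x -> u i x = a ->
     exists b, In (b, cpair i 2) P /\ Iball b x) ->
  certificate M n P I -> exists x, M x /\ Iball I x.
Proof.
  intros HP Hminus Hplus [j [e [Hcov [Hlen [HPj [HI [Hside Hopp]]]]]]].
  apply NNPP. intro Hno.
  assert (Hlab : forall x, box a x -> exists m, (m <= eta j)%nat /\
    Iball (sigma j m) x /\ is_side n (sigma e m)).
  { intros x Hx. destruct (Hcov x (proj1 (proj1 Hx))) as [m [Hm Hxm]].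
    exists m. split; [exact Hm|]. split; [exact Hxm|].
    destruct (lt_eq_lt_dec m (length P)) as [[Hlt|Heq]|Hgt].
    - destruct (HPj m Hlt) as [E1 E2].
      destruct (HP (sigma j m) (sigma e m)) as [H|H]; [| |exact H].
      + rewrite E1, E2, <- surjective_pairing. now apply nth_In.
      + exfalso. exact (H x Hx Hxm).
    - exfalso. apply Hno. exists x. split; [apply Hx|]. rewrite <- HI, <- Heq. exact Hxm.
    - now apply Hside. }
  assert (HinP : forall b l, In (b, l) P -> exists m, (m <= eta j)%nat /\
    sigma j m = b /\ sigma e m = l).
  { intros b l Hbl. destruct (In_nth _ _ (0, 0)%nat Hbl) as [m [Hm E]].
    destruct (HPj m Hm) as [E1 E2]. rewrite E in E1, E2.
    exists m. split; [lia|]. now split. }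
  (* A single lower bound [del] for the distances between all balls with opposite labels. *)
  destruct (uniform_lt (S (eta j)) (fun m del => forall m', (m' < S (eta j))%nat ->
    opposite (sigma e m) (sigma e m') ->
    forall x y, Iball (sigma j m) x -> Iball (sigma j m') y -> del <= d x y))
    as [del [Hdel Hgap]].
  { intros m e1 e2 H1 _ H2 m' Hm' Ho x y Hx Hy. specialize (H1 m' Hm' Ho x y Hx Hy). lra. }
  { intros m Hm. apply (uniform_lt (S (eta j)) (fun m' del =>
      opposite (sigma e m) (sigma e m') ->
      forall x y, Iball (sigma j m) x -> Iball (sigma j m') y -> del <= d x y)).
    - intros m' e1 e2 H1 _ H2 Ho x y Hx Hy. specialize (H1 Ho x y Hx Hy). lra.
    - intros m' Hm'. destruct (classic (opposite (sigma e m) (sigma e m'))) as [Ho|Ho].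
      + assert (Hap : apart (sigma j m) (sigma j m')) by (apply Hopp; auto; lia).
        destruct (apart_gap _ _ Hap) as [e' [He' H]]. exists e'. auto.
      + exists 1. split; [lra|]. contradiction. }
  destruct (u_inverse_uniform (del / 2) ltac:(lra)) as [kap [Hkap Hunif]].
  (* [K] subdivisions of [[-a, a]] have mesh below [kap], so the vertices of a grid cube are mapped
     within [del / 2] of the image of its least vertex. *)
  destruct (archimed_cor1 (kap / (2 * a))) as [K [HK HK0]].
  { apply Rdiv_lt_0_compat; lra. }
  assert (HK1 : 0 < INR K) by now apply lt_0_INR.
  assert (Hmesh : 2 * a / INR K < kap).
  { apply (Rmult_lt_compat_l (2 * a)) in HK; [|lra].
    replace (2 * a * (kap / (2 * a))) with kap in HK by (field; lra). exact HK. }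
  set (co := fun t : nat => 2 * a / INR K * INR t - a).
  assert (Hstep : 0 < 2 * a / INR K) by (apply Rdiv_lt_0_compat; lra).
  assert (co0 : co 0%nat = - a) by (unfold co; simpl; ring).
  assert (coK : co K = a) by (unfold co; field; lra).
  assert (Hco : forall t, (t <= K)%nat -> Rabs (co t) <= a).
  { intros t Ht. assert (co 0%nat <= co t <= co K).
    { unfold co. split; apply Rplus_le_compat_r, Rmult_le_compat_l; try lra;
        apply le_INR; lia. }
    apply Rabs_le. lra. }
  set (p := fun w : nat -> nat => point (fun i => co (w i))).
  assert (Hp : forall w, (forall i, (i < n)%nat -> (w i <= K)%nat) ->
    box a (p w) /\ forall i, (i < n)%nat -> u i (p w) = co (w i)).
  { intros w Hw. apply point_box. auto. }
  assert (Hnear : forall v w, (forall i, (i < n)%nat -> (v i < K)%nat) ->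
    (forall i, (i < n)%nat -> (v i <= w i <= S (v i))%nat) -> d (p v) (p w) < del / 2).
  { intros v w Hv' Hw.
    destruct (Hp v) as [Bv Ev]; [intros i Hi; specialize (Hv' i Hi); lia|].
    destruct (Hp w) as [Bw Ew];
      [intros i Hi; specialize (Hv' i Hi); specialize (Hw i Hi); lia|].
    apply Hunif; auto. intros i Hi. rewrite Ev, Ew by exact Hi. unfold co.
    assert (Hvw : w i = v i \/ w i = Datatypes.S (v i)) by (specialize (Hw i Hi); lia).
    destruct Hvw as [-> | ->].
    - rewrite Rminus_diag, Rabs_R0. exact Hkap.
    - rewrite S_INR. apply Rabs_def1; lra. }
  (* If [p v] lies in a ball labelled [(i, 1)] or [(i, 2)], then [s i] is constant on the
     grid cube at [v], because balls with opposite labels are [del] apart and the cube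
     has diameter below [del / 2]: this contradicts Kuhn's lemma. *)
  set (close := fun i w => exists y m, (m <= eta j)%nat /\ Iball (sigma j m) y /\
    pi1 (sigma e m) = i /\ pi2 (sigma e m) = 2%nat /\ d (p w) y < del / 2).
  set (s := fun i w => if excluded_middle_informative (close i w) then true else false).
  assert (Hfar : forall i v w m, (m <= eta j)%nat -> Iball (sigma j m) (p v) ->
    pi1 (sigma e m) = i -> pi2 (sigma e m) = 1%nat -> d (p v) (p w) < del / 2 ->
    s i w = false).
  { intros i v w m Hm Hball E1 E2 Hvw. unfold s.
    destruct excluded_middle_informative as [[y [m' [Hm' [Hy [E3 [E4 Hwy]]]]]]|];
      [exfalso|reflexivity].
    (* Going from [p v] over [p w] to [y] costs less than two halves of [del], against the gap
       between opposite balls. *)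
    assert (Ho : opposite (sigma e m) (sigma e m')) by (repeat split; congruence).
    pose proof (Hgap m ltac:(lia) m' ltac:(lia) Ho (p v) y Hball Hy).
    pose proof (tri (p v) (p w) y). lra. }
  assert (Hclose : forall i v w m, (m <= eta j)%nat -> Iball (sigma j m) (p v) ->
    pi1 (sigma e m) = i -> pi2 (sigma e m) = 2%nat -> d (p v) (p w) < del / 2 ->
    s i w = true).
  { intros i v w m Hm Hball E1 E2 Hvw. unfold s.
    destruct excluded_middle_informative as [|Hn]; [reflexivity|exfalso].
    apply Hn. exists (p v), m. rewrite (sym (p w)). auto. }
  destruct (kuhn K n s) as [v [Hv' Hkuhn]].
  { intros w i Hw Hi. destruct (Hp w Hw) as [Bw Ew].
    assert (E0 : d (p w) (p w) < del / 2) by (rewrite (d_refl d Hd); lra).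
    split; intro E.
    - destruct (Hminus i (p w) Hi Bw) as [b [Hb Hball]]; [now rewrite Ew, E|].
      destruct (HinP _ _ Hb) as [m [Hm [E1 E2]]].
      apply (Hfar i w w m); auto; rewrite ?E1, ?E2, ?pi1_cpair, ?pi2_cpair; auto.
    - destruct (Hplus i (p w) Hi Bw) as [b [Hb Hball]]; [now rewrite Ew, E|].
      destruct (HinP _ _ Hb) as [m [Hm [E1 E2]]].
      apply (Hclose i w w m); auto; rewrite ?E1, ?E2, ?pi1_cpair, ?pi2_cpair; auto. }
  destruct (Hp v) as [Bv _]; [intros i Hi; specialize (Hv' i Hi); lia|].
  destruct (Hlab (p v) Bv) as [m [Hm [Hball [Hi Hlm]]]].
  destruct (Hkuhn (pi1 (sigma e m)) Hi) as [w [w' [Hw [Hw' Hne]]]].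
  apply Hne. destruct Hlm as [E|E].
  - rewrite (Hfar _ v w m), (Hfar _ v w' m); auto.
  - rewrite (Hclose _ v w m), (Hclose _ v w' m); auto.
Qed.

(** * Existence of certificates near the centre *)

Definition half (c s : R) (i : nat) (t : R) (x : X) : Prop := box c x /\ s * u i x <= t.

(** The part of the cover that does not depend on [I]: within [box a], the half-spaces beyond [a]
    and [- a] are exactly the faces. *)
Definition chart_piece (l : nat) : X -> Prop :=
  match pi2 l with
  | 0%nat => outside
  | 1%nat => half a 1 (pi1 l) (- a)
  | _ => half a (-1) (pi1 l) (- a)
  end.

(** The points of the larger cube lying at least [e] below or above [y] in one coordinate; the
    margin [e] separates opposite pieces. *)
Definition split_piece (y : nat -> R) (e : R) (l : nat) : X -> Prop :=
  match pi2 l with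
  | 1%nat => half (2 * a) 1 (pi1 l) (y (pi1 l) - e)
  | _ => half (2 * a) (-1) (pi1 l) (- (y (pi1 l) + e))
  end.

Lemma compact_chart_piece l : In l (cpair 0 0 :: sides n) -> compact_set d (chart_piece l).
Proof.
  unfold chart_piece. intros [<-|Hl].
  - rewrite pi2_cpair. apply compact_outside.
  - apply in_sides in Hl as [H1 [-> | ->]]; apply compact_half; auto.
    + apply Rabs_R1.
    + rewrite Rabs_left; lra.
Qed.

Lemma compact_split_piece y e l : In l (sides n) -> compact_set d (split_piece y e l).
Proof.
  unfold split_piece. intro Hl.
  apply in_sides in Hl as [H1 [-> | ->]]; apply compact_half; auto.
  - apply Rabs_R1.
  - rewrite Rabs_left; lra.
Qed.

Lemma chart_certificate : exists P del, 0 < del /\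
  (forall I, certificate M n P I -> exists x, M x /\ Iball I x) /\
  (forall I x, M x -> d x0 x < del -> Iball I x -> certificate M n P I).
Proof.
  (* Near the centre the coordinates of [x] stay within [a / 2], so a face and any piece on the
     opposite side differ by at least [a / 2] in that coordinate. *)
  destruct (u_gap (2 * a) (a / 2) ltac:(lra)) as [e1 [He1 Hgap1]].
  destruct outside_gap as [e2 [He2 Hout]].
  (* The bound [e1] serves [apart_near]; [e2 / 2] keeps the balls that cover [outside] away from the
     inner cube. *)
  set (e0 := Rmin e1 (e2 / 2)).
  assert (He0 : 0 < e0) by (apply Rmin_glb_lt; lra).
  assert (He01 : e0 <= e1) by apply Rmin_l.
  assert (He02 : e0 <= e2 / 2) by apply Rmin_r.
  destruct (labelled_cover _ chart_piece e0 compact_chart_piece He0) as [P [HP HPcov]].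
  destruct (u_continuous x0 (a / 2)) as [del [Hdel Hu0]]; [|lra|].
  { split; [exact Hx0|]. rewrite (d_refl d Hd). lra. }
  exists P, (Rmin del r). split; [now apply Rmin_glb_lt|]. split.
  - intro I. apply certificate_sound.
    + intros b l Hbl. destruct (HP b l Hbl) as [[<-|Hl] [Hrho [x [Hx Hxb]]]].
      * left. intros y Hy Hyb. unfold chart_piece in Hx. rewrite pi2_cpair in Hx.
        pose proof (Hout x y Hx Hy).
        assert (d y (lam b) < rho b) by exact Hyb.
        pose proof (tri x (lam b) y). rewrite (sym (lam b) y) in *. lra.
      * right. now apply in_sides.
    + intros i x Hi Hx E. apply HPcov.
      * right. apply in_sides. unfold is_side. rewrite pi1_cpair, pi2_cpair. auto.
      * unfold chart_piece. rewrite pi1_cpair, pi2_cpair. split; [exact Hx|lra].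
    + intros i x Hi Hx E. apply HPcov.
      * right. apply in_sides. unfold is_side. rewrite pi1_cpair, pi2_cpair. auto.
      * unfold chart_piece. rewrite pi1_cpair, pi2_cpair. split; [exact Hx|lra].
  - intros I x Hx Hxx0 HIx.
    pose proof (Rmin_l del r). pose proof (Rmin_r del r).
    assert (Bx : base x) by (split; [exact Hx|lra]).
    assert (Hux : forall i, (i < n)%nat -> Rabs (u i x) < a / 2).
    { intros i Hi. specialize (Hu0 x Bx ltac:(lra) i Hi).
      replace (u i x0) with 0 in Hu0 by (unfold u; ring).
      now rewrite Rminus_0_l, Rabs_Ropp in Hu0. }
    assert (HIx' : d x (lam I) < rho I) by exact HIx.
    (* Points whose coordinates differ from those of [x] by less than [e3] still lie in the ball
       [I]. *)
    destruct (Hgc (f x) (rho I - d x (lam I)) (Hf x (base_N x Bx)) ltac:(lra))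
      as [e3 [He3 Hginv]].
    rewrite (Hgf x (base_N x Bx)) in Hginv.
    (* Opposite split pieces lie [e3 / 2] on either side of [x], hence [e3] apart in that
       coordinate. *)
    destruct (u_gap (2 * a) e3 He3) as [e4 [He4 Hgap4]].
    set (e5 := Rmin e0 e4).
    assert (He5 : 0 < e5) by (apply Rmin_glb_lt; lra).
    assert (He50 : e5 <= e0) by apply Rmin_l.
    assert (He54 : e5 <= e4) by apply Rmin_r.
    destruct (labelled_cover (sides n) (split_piece (fun i => u i x) (e3 / 2)) e5
      (compact_split_piece _ _) He5) as [Q [HQ HQcov]].
    (* [I] sits at index [length P]; its label has side 0 and so is opposite to none. *)
    set (L := P ++ (I, cpair 0 0) :: Q).
    assert (HL : L <> []) by (unfold L; destruct P; discriminate).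
    destruct (realize_list L HL) as [j [e [Hj Hje]]].
    assert (HLlen : length L = (length P + Datatypes.S (length Q))%nat)
      by (unfold L; now rewrite length_app).
    assert (Hin : forall m, (m <= eta j)%nat -> In (sigma j m, sigma e m) L).
    { intros m Hm. destruct (Hje m) as [-> ->]; [lia|].
      rewrite <- surjective_pairing. apply nth_In. lia. }
    assert (Hlow : forall b l, In (b, l) L -> (pi2 l = 1)%nat -> (pi1 l < n)%nat /\
      exists z, box (2 * a) z /\ d z (lam b) < e0 /\ rho b < e0 /\
        (u (pi1 l) z <= - a \/
         d z (lam b) < e5 /\ rho b < e5 /\ u (pi1 l) z <= u (pi1 l) x - e3 / 2)).
    { intros b l Hbl El. apply in_app_or in Hbl as [Hbl|[[= _ <-]|Hbl]].
      - destruct (HP b l Hbl) as [[<-|Hl] [Hrho [z [Hz Hzb]]]].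
        { rewrite pi2_cpair in El. discriminate. }
        apply in_sides in Hl as [Hl _]. split; [exact Hl|].
        unfold chart_piece in Hz. rewrite El in Hz. destruct Hz as [Bz Hz].
        exists z. split; [apply (box_weaken a); [lra|exact Bz]|].
        split; [exact Hzb|]. split; [exact Hrho|left; lra].
      - rewrite pi2_cpair in El. discriminate.
      - destruct (HQ b l Hbl) as [Hl [Hrho [z [Hz Hzb]]]].
        apply in_sides in Hl as [Hl _]. split; [exact Hl|].
        unfold split_piece in Hz. rewrite El in Hz. destruct Hz as [Bz Hz].
        exists z. split; [exact Bz|]. split; [lra|].
        split; [lra|right; repeat split; lra]. }
    assert (Hup : forall b l, In (b, l) L -> (pi2 l = 2)%nat -> (pi1 l < n)%nat /\
      exists z, box (2 * a) z /\ d z (lam b) < e0 /\ rho b < e0 /\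
        (a <= u (pi1 l) z \/
         d z (lam b) < e5 /\ rho b < e5 /\ u (pi1 l) x + e3 / 2 <= u (pi1 l) z)).
    { intros b l Hbl El. apply in_app_or in Hbl as [Hbl|[[= _ <-]|Hbl]].
      - destruct (HP b l Hbl) as [[<-|Hl] [Hrho [z [Hz Hzb]]]].
        { rewrite pi2_cpair in El. discriminate. }
        apply in_sides in Hl as [Hl _]. split; [exact Hl|].
        unfold chart_piece in Hz. rewrite El in Hz. destruct Hz as [Bz Hz].
        exists z. split; [apply (box_weaken a); [lra|exact Bz]|].
        split; [exact Hzb|]. split; [exact Hrho|left; lra].
      - rewrite pi2_cpair in El. discriminate.
      - destruct (HQ b l Hbl) as [Hl [Hrho [z [Hz Hzb]]]].
        apply in_sides in Hl as [Hl _]. split; [exact Hl|].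
        unfold split_piece in Hz. rewrite El in Hz. destruct Hz as [Bz Hz].
        exists z. split; [exact Bz|]. split; [lra|].
        split; [lra|right; repeat split; lra]. }
    exists j, e. split; [|split; [|split; [|split; [|split]]]].
    + intros y Hy.
      (* A point is outside, or on one side of [x] in some coordinate, or so close to [x] in all
         coordinates that it lies in [I]. *)
      assert (Hy' : exists b l, In (b, l) L /\ Iball b y).
      { destruct (classic (outside y)) as [Hoy|Hoy].
        { destruct (HPcov (cpair 0 0) y) as [b [Hb Hyb]].
          - simpl. auto.
          - unfold chart_piece. now rewrite pi2_cpair.
          - exists b, (cpair 0 0). split; [|exact Hyb]. apply in_or_app. auto. }
        assert (Hby : d x0 y < r /\ forall i, (i < n)%nat -> Rabs (u i y) < 2 * a).
        { apply NNPP. intro H'. apply Hoy. now split. }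
        destruct Hby as [Hyr Huy].
        assert (By : box (2 * a) y).
        { split; [split; [exact Hy|lra]|]. intros i Hi. specialize (Huy i Hi). lra. }
        assert (HQL : forall b l, In (b, l) Q -> In (b, l) L).
        { intros b l Hbl. apply in_or_app. simpl. auto. }
        destruct (classic (exists i, (i < n)%nat /\ u i y <= u i x - e3 / 2))
          as [[i [Hi Hiy]]|Hn1].
        { destruct (HQcov (cpair i 1) y) as [b [Hb Hyb]]; [| |eauto].
          - apply in_sides. unfold is_side. rewrite pi1_cpair, pi2_cpair. auto.
          - unfold split_piece. rewrite pi1_cpair, pi2_cpair. split; [exact By|lra]. }
        destruct (classic (exists i, (i < n)%nat /\ u i x + e3 / 2 <= u i y))
          as [[i [Hi Hiy]]|Hn2].
        { destruct (HQcov (cpair i 2) y) as [b [Hb Hyb]]; [| |eauto].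
          - apply in_sides. unfold is_side. rewrite pi1_cpair, pi2_cpair. auto.
          - unfold split_piece. rewrite pi1_cpair, pi2_cpair. split; [exact By|lra]. }
        exists I, (cpair 0 0). split; [apply in_or_app; simpl; auto|].
        assert (Ny : N y) by apply (base_N y (proj1 By)).
        assert (Hxy : d x y < rho I - d x (lam I)).
        { rewrite <- (Hgf y Ny). apply Hginv; [now apply Hf|]. intros i Hi.
          assert (~ u i y <= u i x - e3 / 2) by (intro; eauto).
          assert (~ u i x + e3 / 2 <= u i y) by (intro; eauto).
          unfold u in *. apply Rabs_def1; lra. }
        pose proof (tri y x (lam I)). rewrite (sym y x) in *.
        change (d y (lam I) < rho I). lra. }
      destruct Hy' as [b [l [Hbl Hyb]]].
      destruct (In_nth _ _ (0, 0)%nat Hbl) as [m [Hm E]].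
      exists m. split; [lia|].
      destruct (Hje m Hm) as [-> _]. rewrite E. exact Hyb.
    + lia.
    + intros k Hk. destruct (Hje k) as [-> ->]; [lia|].
      unfold L. rewrite app_nth1 by exact Hk. auto.
    + destruct (Hje (length P)) as [-> _]; [lia|].
      unfold L. rewrite app_nth2 by lia. now rewrite Nat.sub_diag.
    + intros m Hm Hlt. destruct (Hje m) as [_ ->]; [lia|].
      unfold L. rewrite app_nth2 by lia.
      replace (m - length P)%nat with (Datatypes.S (m - length P - 1)) by lia.
      cbn [nth]. apply in_sides.
      apply (HQ (fst (nth (m - length P - 1) Q (0, 0)%nat))).
      rewrite <- surjective_pairing. apply nth_In. lia.
    + intros m Hm m' Hm' [E1 [E2 E3]].
      destruct (Hlow _ _ (Hin m Hm) E2) as [Hi [z [Bz [Hz1 [Hz2 Hz3]]]]].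
      destruct (Hup _ _ (Hin m' Hm') E3) as [_ [z' [Bz' [Hz1' [Hz2' Hz3']]]]].
      rewrite <- E1 in Hz3'. specialize (Hux _ Hi). apply Rabs_def2 in Hux.
      (* If a face is involved the coarse scale [e0] suffices; two split pieces need the finer scale
         [e5]. *)
      destruct Hz3 as [Hz3|[Hz4 [Hz5 Hz3]]]; [|destruct Hz3' as [Hz3'|[Hz4' [Hz5' Hz3']]]].
      * apply (apart_near _ _ z z' e0); auto.
        pose proof (Hgap1 _ z z' Hi Bz Bz' ltac:(destruct Hz3'; lra)). lra.
      * apply (apart_near _ _ z z' e0); auto.
        pose proof (Hgap1 _ z z' Hi Bz Bz' ltac:(lra)). lra.
      * apply (apart_near _ _ z z' e5); auto.
        pose proof (Hgap4 _ z z' Hi Bz Bz' ltac:(lra)). lra.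
Qed.

End Chart.

(** Cuts a neighbourhood of [x0] down to a ball and a cube that satisfy the assumptions of the chart
    section. *)
Lemma manifold_certificate M x0 : compact_set d M -> is_manifold d M -> M x0 ->
  exists n P del, 0 < del /\
    (forall I, certificate M n P I -> exists x, M x /\ Iball I x) /\
    (forall I x, M x -> d x0 x < del -> Iball I x -> certificate M n P I).
Proof.
  intros HM [_ [n [_ Hman]]] Hx0. exists n.
  destruct (Hman x0 Hx0) as [N [HNM [[U [HU [HUx HUN]]]
    [f [g [Hf [Hg [Hgf [Hfg [Hfc Hgc]]]]]]]]]].
  destruct (HU x0 HUx) as [r [Hr HrU]].
  assert (Nx0 : N x0) by auto.
  destruct (Hgc (f x0) (r / 2) (Hf x0 Nx0) ltac:(lra)) as [a [Ha Hga]].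
  rewrite (Hgf x0 Nx0) in Hga.
  (* Halving [r] puts the closed ball inside the open one; with [a / 4] the doubled cube has
     half-width [a / 2], below the [a] allowed by [Hga]. *)
  apply (chart_certificate M HM n N f g HNM Hf Hg Hgf Hfg Hfc Hgc x0 Hx0 (r / 2) (a / 4)).
  - lra.
  - lra.
  - intros y Hy Hxy. apply HUN; [|exact Hy]. apply HrU. lra.
  - intros w Hw Hwx. apply Hga; [exact Hw|]. intros i Hi. specialize (Hwx i Hi).
    rewrite Rabs_minus_sym in Hwx. lra.
Qed.

Lemma manifold_meets_re M : compact_set d M -> is_manifold d M ->
  ce (fun j => forall x, M x -> Junion j x) ->
  re (fun i => exists x, M x /\ Iball i x).
Proof.
  intros HM Hman HJ.
  (* The data of a chart need not be found effectively: finitely many fixed [(n, P)] serve all of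
     [M], and a finite union of enumerable sets is enumerable. *)
  destruct (compact_indexed d M
    (fun c : X * R * nat * list (nat * nat) =>
       (forall I, certificate M (snd (fst c)) (snd c) I -> exists x, M x /\ Iball I x) /\
       (forall I x, M x -> d (fst (fst (fst c))) x < snd (fst (fst c)) -> Iball I x ->
          certificate M (snd (fst c)) (snd c) I))
    (fun c y => d (fst (fst (fst c))) y < snd (fst (fst c))) HM) as [cs [Hcs Hcov]].
  - intros c _. apply (ball_open d HXd).
  - intros x Hx. destruct (manifold_certificate M x HM Hman Hx) as [n [P [del [Hdel H]]]].
    exists (x, del, n, P). cbn [fst snd]. rewrite (d_refl d HXd). auto.
  - apply (re_ext (fun i => exists c, In c cs /\ certificate M (snd (fst c)) (snd c) i)).
    + intro i. split.
      * intros [c [Hc H]]. now apply (Hcs c Hc).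
      * intros [x [Hx Hix]]. destruct (Hcov x Hx) as [c [Hc Hcx]].
        exists c. split; [exact Hc|]. exact (proj2 (Hcs c Hc) i x Hx Hcx Hix).
    + apply re_ex_in. intros c _. now apply certificate_re.
Qed.

End Certificates.

Theorem theorem6p3 :
  forall (X : Type) (d : X -> X -> R) (alpha : nat -> X),
  computable_metric_space d alpha ->
  forall (q : nat -> R) (tau1 tau2 : nat -> nat)
         (sigma : nat -> nat -> nat) (eta : nat -> nat),
  valid_enums q tau1 tau2 sigma eta ->
  forall S : X -> Prop,
  semi_computable_compact d alpha q tau1 tau2 sigma eta S ->
  is_manifold d S ->
  computable_compact d alpha q tau1 tau2 sigma eta S.
Proof.
  intros X d alpha HX q tau1 tau2 sigma eta Hv M [HM HJ] Hman.
  split; [now split|]. apply re_ce.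
  exact (manifold_meets_re d alpha q tau1 tau2 sigma eta HX Hv M HM Hman HJ).
Qed.
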